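(* Let $n\ge1$, $k=\lceil n/2\rceil$ (so $n=2k-1$ or $n=2k$), $q=(q_1,\dots,q_k)\in(0,1)^k$ and $z\in\mathcal W_0^k$. Let $(\mathfrak X(t);t\ge0)$ be the continuous-time Markov process on the set $\mathbb K^0_n$ of symplectic Gelfand-Tsetlin patterns with the blocking-and-pushing dynamics with wall at the origin described in the context. If $\mathfrak X(0)$ has distribution $M^n_z(\cdot)$, then the bottom row $(\mathfrak X^n(t);t\ge0)$ is distributed as a Markov process on $\mathcal W^k_0$ with $Q$-matrix $Q_n$, started from $z$.
   Context: $\mathbb Z_+=\{0,1,2,\dots\}$; $\mathcal W_0^k=\{z\in\mathbb Z^k:0\le z_1\le z_2\le\dots\le z_k\}$; $e_i$ is the $i$-th standard basis vector. For $x,y\in\mathbb R^m$, $x\prec y$ means $x_1\le y_1\le x_2\le\dots\le y_{m-1}\le x_m\le y_m$. For $x\in\mathbb R^m$, $y\in\mathbb R^{m+1}$, $x\preceq y$ means $y_i\le x_i\le y_{i+1}$ for $1\le i\le m$. Symplectic patterns: $\mathbb K^0_n$ is the set of $(x^1,\dots,x^n)$ such that $x^{2i-1},x^{2i}\in\mathbb Z_+^i$ for $1\le i\le\lfloor n/2\rfloor$ and $x^n\in\mathbb Z_+^{(n+1)/2}$ if $n$ is odd; $x^{2i-1}\prec x^{2i}$ for $1\le i\le\lfloor n/2\rfloor$; and $x^{2i}\preceq x^{2i+1}$ for $1\le i\le\lfloor (n-1)/2\rfloor$. For $z\in\mathcal W_0^k$, $\mathbb K^0_n(z)=\{x\in\mathbb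 K^0_n:x^n=z\}$. Weights: $|z|=\sum_i z_i$, $|x^0|=0$, empty products equal $1$; $$w^q_{2k-1}(x)=q_k^{|x^{2k-1}|-|x^{2k-2}|}\prod_{i=1}^{k-1}q_i^{2|x^{2i-1}|-|x^{2i-2}|-|x^{2i}|},\qquad w^q_{2k}(x)=\prod_{i=1}^{k}q_i^{2|x^{2i-1}|-|x^{2i-2}|-|x^{2i}|}.$$ Symplectic Schur function: $Sp^n_z(q)=\sum_{x\in\mathbb K^0_n(z)}w^q_n(x)$. Initial law: $M^n_z(x)=w^q_n(x)/Sp^n_z(q)$, a probability distribution on $\mathbb K^0_n(z)$. $Q$-matrix $Q_n$ on $\mathcal W^k_0$: for $x\in\mathcal W_0^k$ and $x\pm e_i\in\mathcal W_0^k$, $Q_n(x,x\pm e_i)=Sp^n_{x\pm e_i}(q)/Sp^n_x(q)$; all other off-diagonal entries vanish; and the diagonal entries are given by $$-Q_{2k-1}(x,x)=\sum_{i=1}^{k-1}(q_i+q_i^{-1})+q_k^{-1}\mathbf 1_{[x_1>0]}+q_k,\qquad -Q_{2k}(x,x)=\sum_{i=1}^k(q_i+q_i^{-1}).$$ Dynamics of $\mathfrak X$: the components $\mathfrak X^m_j$ are particles on $\mathbb Z_+$. Independently, each particle in row $2i-1$ attempts unit jumps to the right at rate $q_i$ and to the left at rate $q_i^{-1}$; each particle in row $2i$ attempts unit jumps to the right at rate $q_i^{-1}$ and to the left at rate $q_i$. Blocking: an attempted jump is suppressed if it would violate the interlacing with the row immediately above, or if it is a leftward jump from the origin by the first particle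 $\mathfrak X^{2i-1}_1$ of an odd row. Otherwise it succeeds. Pushing: when a particle in some row jumps (of its own accord or because it is pushed) and the interlacing with the row immediately below would be violated, the obstructing particle in the row below (which was at the same site) is simultaneously moved by one unit in the same direction. Explicitly, from row $2i-1$ to row $2i$: a right jump of $\mathfrak X^{2i-1}_j$ pushes $\mathfrak X^{2i}_j$ if $\mathfrak X^{2i}_j=\mathfrak X^{2i-1}_j$, and a left jump of $\mathfrak X^{2i-1}_{j+1}$ pushes $\mathfrak X^{2i}_j$ if $\mathfrak X^{2i}_j=\mathfrak X^{2i-1}_{j+1}$. From row $2i$ to row $2i+1$: a right jump of $\mathfrak X^{2i}_j$ pushes $\mathfrak X^{2i+1}_{j+1}$ if $\mathfrak X^{2i+1}_{j+1}=\mathfrak X^{2i}_j$, and a left jump of $\mathfrak X^{2i}_j$ pushes $\mathfrak X^{2i+1}_j$ if $\mathfrak X^{2i+1}_j=\mathfrak X^{2i}_j$. Equality of positions is just before the jump. *)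

(* Defs.v *)
From HB Require Import structures.
From mathcomp Require Import all_boot all_order all_algebra.
From mathcomp Require Import all_classical all_reals all_analysis.

Set Implicit Arguments.
Unset Strict Implicit.
Unset Printing Implicit Defensive.

Import Order.TTheory GRing.Theory Num.Theory.
Import numFieldNormedType.Exports.

Local Open Scope classical_set_scope.
Local Open Scope ring_scope.

(* The parameter n below stands for patterns with n.+1 >= 1 rows, and
   n./2.+1 is the integer ceil((n+1)/2), called k in the mathematics.  Types
   'I_n.+1 and 'I_n./2.+1 index rows, particles and parameters from 0;
   [rowno] and [colno] recover the usual numbering from 1. *)

Definition vec (k : nat) := {ffun 'I_k -> int}.

Definition weyl0 k : set (vec k) :=
  [set z : vec k | (forall i, 0 <= z i) /\
                   (forall i j : 'I_k, (i <= j)%N -> z i <= z j)].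
Arguments weyl0 k : clear implicits.

(* x_1 <= y_1 <= x_2 <= ... <= y_{m-1} <= x_m <= y_m, used for a = b = m; the
   lengths are kept apart because consecutive row lengths of a pattern are not
   convertible. *)
Definition prec a b (x : vec a) (y : vec b) : Prop :=
  forall (i : 'I_a) (j : 'I_b),
    (i = j :> nat -> x i <= y j) /\ (i = j.+1 :> nat -> y j <= x i).

(* y_i <= x_i <= y_{i+1} for 1 <= i <= m, used for a = m and b = m + 1. *)
Definition preceq a b (x : vec a) (y : vec b) : Prop :=
  forall (i : 'I_a) (j : 'I_b),
    (j = i :> nat -> y j <= x i) /\ (j = i.+1 :> nat -> x i <= y j).

Section Patterns.
Variable n : nat.

Definition particle := {m : 'I_n.+1 & 'I_m./2.+1}.

Definition config := {ffun particle -> int}.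

Definition rowno (p : particle) : nat := (tag p).+1.
Definition colno (p : particle) : nat := (tagged p).+1.

Definition row_of (x : config) (m : 'I_n.+1) : vec m./2.+1 :=
  [ffun j => x (Tagged (fun m : 'I_n.+1 => 'I_m./2.+1) j)].

Definition bottom_row (x : config) : vec n./2.+1 := row_of x ord_max.

Definition interlaced (x : config) (m m' : 'I_n.+1) : Prop :=
  if odd m.+1 then prec (row_of x m) (row_of x m')
  else preceq (row_of x m) (row_of x m').

Definition patterns : set config :=
  [set x : config | (forall p, 0 <= x p) /\
           (forall m m' : 'I_n.+1, m' = m.+1 :> nat -> interlaced x m m')].

Definition patterns_at (z : vec n./2.+1) : set config :=
  [set x : config | patterns x /\ bottom_row x = z].

(* |x^m| for the usual row number m >= 1, and |x^0| = 0. *)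
Definition rowsum (x : config) (m : nat) : int := \sum_(p | rowno p == m) x p.

(* A direction is a boolean, true meaning to the right. *)

Definition step (right : bool) : int := if right then 1 else -1.

Definition move_alone (right : bool) (p : particle) (x : config) : config :=
  [ffun p' => if p' == p then x p' + step right else x p'].

Definition blocked (right : bool) (p : particle) (x : config) : Prop :=
  (exists2 m : 'I_n.+1, tag p = m.+1 :> nat
     & ~ interlaced (move_alone right p x) m (tag p))
  \/ [/\ ~~ right, odd (rowno p), colno p = 1%N & x p = 0].

Definition pushes (right : bool) (x : config) : rel particle := fun p p' =>
  [&& rowno p' == (rowno p).+1,
      if odd (rowno p)
      then if right then colno p' == colno p else (colno p').+1 == colno p
      else if right then colno p' == (colno p).+1 else colno p' == colno p
    & x p' == x p].

(* [connect] is the reflexive-transitive closure: p itself jumps, and pushes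
   propagate down the rows; all sites are compared before the jump. *)
Definition jump (right : bool) (p : particle) (x : config) : config :=
  [ffun p' => if connect (pushes right x) p p' then x p' + step right
            else x p'].

Variables (R : realType) (q : 'I_n./2.+1 -> R).

(* Rows 2i-1 and 2i both carry the parameter q_i. *)
Definition param (p : particle) : R := q (inord (tag p)./2).

Definition attempt_rate (right : bool) (p : particle) : R :=
  if odd (rowno p) == right then param p else (param p)^-1.

Definition pattern_qmatrix (x y : config) : R :=
  \sum_(p : particle) \sum_(right : bool)
    if `[< blocked right p x >] then 0
    else attempt_rate right p * ((y == jump right p x)%:R - (y == x)%:R).

(* The case distinction singles out the last parameter when the number n.+1
   of rows is odd. *)
Definition wt_exponent (x : config) (i : 'I_n./2.+1) : int :=
  if i.*2.+1 == n.+1 then rowsum x i.*2.+1 - rowsum x i.*2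
  else rowsum x i.*2.+1 *+ 2 - rowsum x i.*2 - rowsum x i.*2.+2.

Definition wt (x : config) : R := \prod_i q i ^ wt_exponent x i.

Definition Sp (z : vec n./2.+1) : R := \sum_(x \in patterns_at z) wt x.

Definition initial_law (z : vec n./2.+1) (x : config) : R :=
  if `[< patterns_at z x >] then wt x / Sp z else 0.

Definition shifted (x : vec n./2.+1) (right : bool) (i : 'I_n./2.+1) :
    vec n./2.+1 :=
  [ffun j => if j == i then x j + step right else x j].

(* Only its restriction to weyl0 x weyl0 is meaningful. *)
Definition bottom_qmatrix (x y : vec n./2.+1) : R :=
  if y == x then
    - (if odd n.+1 then
         \sum_(i | i != ord_max) (q i + (q i)^-1)
         + (q ord_max)^-1 * (0 < x ord0)%R%:R + q ord_max
       else \sum_i (q i + (q i)^-1))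
  else if [exists right, exists i, y == shifted x right i] then Sp y / Sp x
  else 0.

End Patterns.

Arguments patterns n : clear implicits.

Section MarkovProcesses.
Context (R : realType) (T : countType).

(* A standard (honest) transition function on S whose derivative at 0+ is Q.
   When the diagonal of Q is bounded on S, as for the Q-matrices above, Q
   determines P. *)
Definition transition_function (S : set T) (Q : T -> T -> R)
    (P : R -> T -> T -> R) : Prop :=
  [/\ forall (t : R) x y, 0 <= t -> S x -> S y -> 0 <= P t x y,
      forall (t : R) x, 0 <= t -> S x -> \esum_(y in S) (P t x y)%:E = 1%E,
      forall x y, S x -> S y -> P 0 x y = (x == y)%:R,
      forall (s t : R) x z, 0 <= s -> 0 <= t -> S x -> S z ->
        (P (s + t) x z)%:E = \esum_(y in S) (P s x y * P t y z)%:E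
    & forall x y, S x -> S y ->
        h^-1 * (P h x y - (x == y)%:R) @[h --> 0^'+] --> Q x y].

Definition markov_property d (Omega : measurableType d)
    (Pr : probability Omega R) (S : set T) (P : R -> T -> T -> R)
    (X : R -> Omega -> T) : Prop :=
  forall (past : seq (R * T)) (t h : R) (x y : T),
    all (fun a : R * T => 0 <= a.1 <= t) past -> 0 <= t -> 0 <= h -> S x -> S y ->
    let A := [set w | all (fun a : R * T => X a.1 w == a.2) past /\ X t w = x] in
    Pr (A `&` [set w | X (t + h) w = y]) = (Pr A * (P h x y)%:E)%E.

(* X = (X t; t >= 0) is a Markov process on S with Q-matrix Q and initial law
   mu, with right-continuous paths for the discrete topology on S. *)
Definition markov_process d (Omega : measurableType d)
    (Pr : probability Omega R) (S : set T) (Q : T -> T -> R) (mu : T -> R)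
    (X : R -> Omega -> T) : Prop :=
  [/\ forall (t : R) w, 0 <= t -> S (X t w),
      forall (t : R) w, 0 <= t -> \forall s \near t^'+, X s w = X t w,
      forall (t : R) x, 0 <= t -> measurable [set w | X t w = x],
      forall x, S x -> Pr [set w | X 0 w = x] = (mu x)%:E
    & exists2 P : R -> T -> T -> R,
        transition_function S Q P & markov_property Pr S P X].

End MarkovProcesses.

(* Main.v *)
Require Import Defs.
From mathcomp Require Import all_boot all_order all_algebra.
From mathcomp Require Import all_classical all_reals all_analysis.
From mathcomp Require Import finmap ring lra zify.
Import Order.TTheory GRing.Theory Num.Theory.
Import numFieldNormedType.Exports.
Local Open Scope classical_set_scope.
Local Open Scope ring_scope.

(* Write Q for the generator on patterns, Q' for the one on bottom rows, and
   L x = w(x) / Sp(bottom row of x).  The heart of the matter is the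
   intertwining: for every z and every pattern y,
     sum over x with bottom row z of L x Q(x, y) = Q'(z, bottom row of y) L y.
   Let rho_m be the right rate in row m (the left rate is 1 / rho_m) and put
   rho_m = 1 below the bottom row.  Then w(x) is the product over the particles
   p, in row m say, of (rho_m / rho_(m+1)) ^ x_p, so for a jump x -> y started
   in row m whose pushes end at row m', w(x) times the rate telescopes to w(y)
   times rho_(m'+1), or 1 / rho_(m'+1) for a left jump.  Given y, the direction
   and the last moved particle, x is recovered by going up along the particles
   at the same site that could have pushed.  Jumps ending in row m contribute to
   the flow into y what the jumps out of y started in row m + 1 contribute to
   the flow out of it, up to boundary terms that sum to the diagonal of Q'.

   The intertwining passes to the transition functions without constructing
   exp(tQ').  Since Q is bounded, P_h = I + h Q + O(h^2) uniformly, so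
   G_t(z, y), the L-average of P_t(x, y) over the fiber of z, solves the backward
   equation of Q' up to O(h^2) per step of length h.  If y1 and y2 have the same
   bottom row, L y2 G_t(., y1) - L y1 G_t(., y2) vanishes at t = 0, hence always
   by a discrete Gronwall argument.  Thus G_t(z, y) = L y P'_t(z, bottom row of
   y), which defines P'_t, and given the past of the bottom row the pattern has
   law L on the fiber. *)

(** * Images of Markov processes under an intertwining *)

Section ExtendedSums.
Context (R : realType) (T : countType).
Implicit Types (S : set T) (F : seq T) (p f : T -> R).

Lemma esum_seq F f : uniq F -> (forall y, y \in F -> 0 <= f y) ->
  \esum_(y in [set` F]) (f y)%:E = (\sum_(y <- F) f y)%:E.
Proof.
move=> uF f0; rewrite esum_fset.
- by rewrite -fsbig_seq; [rewrite sumEFin|].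
- exact: finite_seq.
- by move=> i /set_mem /= /f0; rewrite lee_fin.
Qed.

Lemma esum_split S F f : uniq F -> (forall y, y \in F -> S y) ->
  (forall y, S y -> 0 <= f y) ->
  \esum_(y in S) (f y)%:E =
  ((\sum_(y <- F) f y)%:E + \esum_(y in S `&` ~` [set` F]) (f y)%:E)%E.
Proof.
move=> uF FS f0; rewrite (esumID [set` F]); last by move=> y /f0; rewrite lee_fin.
have -> : S `&` [set` F] = [set` F] by apply/setIidr => y /= /FS.
by rewrite esum_seq// => y /FS /f0.
Qed.

Lemma esum_le S f (r : \bar R) :
  (forall F, uniq F -> (forall y, y \in F -> S y) ->
     (\sum_(y <- F) f y)%:E <= r)%E ->
  (\esum_(y in S) (f y)%:E <= r)%E.
Proof.
move=> le_r; apply: ge_ereal_sup => _ [X [fX XS] <-].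
rewrite fsbig_finite// sumEFin; apply: le_r; first exact: fset_uniq.
by move=> y; rewrite in_fset_set// => /set_mem /XS.
Qed.

Lemma le_esum_seq S f F : uniq F -> (forall y, y \in F -> S y) ->
  (forall y, S y -> 0 <= f y) ->
  ((\sum_(y <- F) f y)%:E <= \esum_(y in S) (f y)%:E)%E.
Proof.
move=> uF FS f0; rewrite (esum_split _ _ _ uF)// leeDl// esum_ge0// => y [Sy _].
by rewrite lee_fin f0.
Qed.

Lemma esumZl S f (a : R) : 0 <= a -> (forall y, S y -> 0 <= f y) ->
  \esum_(y in S) (a * f y)%:E = (a%:E * \esum_(y in S) (f y)%:E)%E.
Proof.
move=> a0 f0; have af0 y : S y -> 0 <= a * f y by move=> /f0; exact: mulr_ge0.
apply/eqP; rewrite eq_le; apply/andP; split.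
  apply: esum_le => F uF FS; rewrite -mulr_sumr EFinM lee_wpmul2l ?lee_fin//.
  exact: le_esum_seq.
have [->|a_neq0] := eqVneq a 0.
  by rewrite mul0e esum_ge0// => y Sy; rewrite mul0r.
have a_gt0 : 0 < a by rewrite lt_neqAle eq_sym a_neq0.
rewrite muleC -lee_pdivlMr//; apply: esum_le => F uF FS.
rewrite lee_pdivlMr// -EFinM mulrC mulr_sumr.
exact: le_esum_seq.
Qed.

(** The mass of [p] outside [F] is [1 - \sum_(y <- F) p y], and [f] is at most [b] there. This turns
    infinite Chapman-Kolmogorov sums into inequalities between finite ones. *)
Lemma expectation_bounds S F p f (r b : R) : uniq F -> (forall y, y \in F -> S y) ->
  (forall y, S y -> 0 <= p y) -> \esum_(y in S) (p y)%:E = 1%E ->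
  (forall y, S y -> 0 <= f y) -> (forall y, S y -> y \notin F -> f y <= b) ->
  0 <= b -> r%:E = \esum_(y in S) (p y * f y)%:E ->
  [/\ \sum_(y <- F) p y <= 1, \sum_(y <- F) p y * f y <= r
    & r <= \sum_(y <- F) p y * f y + b * (1 - \sum_(y <- F) p y)].
Proof.
move=> uF FS p0 p1 f0 fb b0 rE.
have pf0 y : S y -> 0 <= p y * f y by move=> Sy; rewrite mulr_ge0 ?p0 ?f0.
have sp1 : \sum_(y <- F) p y <= 1.
  by rewrite -lee_fin -[leRHS]p1; apply: le_esum_seq.
split=> //.
  by rewrite -lee_fin rE; apply: le_esum_seq.
rewrite -lee_fin rE (esum_split S F)// EFinD leeD2l//.
have : (\esum_(y in S `&` ~` [set` F]) (p y * f y)%:E <=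
        \esum_(y in S `&` ~` [set` F]) (b * p y)%:E)%E.
  apply: le_esum => y [Sy /negP yF]; rewrite lee_fin mulrC ler_wpM2r ?p0 ?fb//.
move=> /le_trans; apply; rewrite esumZl//; last by move=> y [/p0].
rewrite EFinM lee_wpmul2l ?lee_fin//.
move: p1; rewrite (esum_split S F)//; case: esum => [e|//|//].
by rewrite -EFinD => -[<-]; rewrite addrC addKr.
Qed.

End ExtendedSums.

(** * Uniform second-order expansion of a transition function with bounded exit rates *)

Section SecondOrder.
Context (R : realType) (T : countType) (S : set T) (Q : T -> T -> R)
  (P : R -> T -> T -> R) (c : R).
Hypothesis tf : transition_function S Q P.
Hypothesis Qc : forall x, S x -> - Q x x <= c.

Let P_ge0 (t : R) x y : 0 <= t -> S x -> S y -> 0 <= P t x y.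
Proof. by case: tf => + _ _ _ _; exact. Qed.

Let P_sum (t : R) x : 0 <= t -> S x -> \esum_(y in S) (P t x y)%:E = 1%E.
Proof. by case: tf => _ + _ _ _; exact. Qed.

Let P_0 x y : S x -> S y -> P 0 x y = (x == y)%:R.
Proof. by case: tf => _ _ + _ _; exact. Qed.

Let P_D (s t : R) x z : 0 <= s -> 0 <= t -> S x -> S z ->
  (P (s + t) x z)%:E = \esum_(y in S) (P s x y * P t y z)%:E.
Proof. by case: tf => _ _ _ + _; exact. Qed.

Lemma transition_le1 (t : R) x y : 0 <= t -> S x -> S y -> P t x y <= 1.
Proof.
move=> t0 Sx Sy; rewrite -lee_fin -(P_sum t x)//.
have := @le_esum_seq R T S (P t x) [:: y]; rewrite big_seq1; apply => //.
- by move=> y'; rewrite inE => /eqP ->.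
- by move=> y' Sy'; exact: P_ge0.
Qed.

Lemma chapman_bounds F (s t b : R) x y : uniq F -> (forall x', x' \in F -> S x') ->
  0 <= s -> 0 <= t -> S x -> S y -> 0 <= b ->
  (forall x', S x' -> x' \notin F -> P t x' y <= b) ->
  [/\ \sum_(x' <- F) P s x x' <= 1,
      \sum_(x' <- F) P s x x' * P t x' y <= P (s + t) x y &
      P (s + t) x y <= \sum_(x' <- F) P s x x' * P t x' y
                       + b * (1 - \sum_(x' <- F) P s x x')].
Proof.
move=> uF FS s0 t0 Sx Sy b0 Pb.
apply: (@expectation_bounds R T S F (P s x) (P t ^~ y)) => //.
- by move=> x' Sx'; exact: P_ge0.
- exact: P_sum.
- by move=> x' Sx'; exact: P_ge0.
- exact: P_D.
Qed.

Let exit_ge0 (t : R) x : 0 <= t -> S x -> 0 <= 1 - P t x x.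
Proof. by move=> t0 Sx; rewrite subr_ge0 transition_le1. Qed.

(** Staying at [x] in both periods gives [P (s + t) x x >= P s x x * P t x x]; the rest is
    [(1 - P s x x) * (1 - P t x x) >= 0]. *)
Lemma exit_subadditive (s t : R) x : 0 <= s -> 0 <= t -> S x ->
  1 - P (s + t) x x <= (1 - P s x x) + (1 - P t x x).
Proof.
move=> s0 t0 Sx.
have [_ + _] : [/\ _, _ & _] := @chapman_bounds [:: x] s t 1 x x isT
  (fun x' => ltac:(rewrite inE => /eqP ->; exact: Sx)) s0 t0 Sx Sx ler01
  (fun x' Sx' _ => transition_le1 t x' x t0 Sx' Sx).
rewrite big_seq1; have := mulr_ge0 (exit_ge0 _ _ s0 Sx) (exit_ge0 _ _ t0 Sx).
nra.
Qed.

Lemma exit_natmul (t : R) x m : 0 <= t -> S x ->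
  1 - P (m%:R * t) x x <= m%:R * (1 - P t x x).
Proof.
move=> t0 Sx; elim: m => [|m IHm]; first by rewrite !mul0r P_0// eqxx subrr.
rewrite -natr1 !mulrDl !mul1r (le_trans (exit_subadditive _ _ _ _ _ _))//.
  by rewrite mulr_ge0.
by rewrite lerD2r.
Qed.

Lemma transition_cvg (h : R) x y : 0 < h -> S x -> S y ->
  (m.+1%:R * (P (h / m.+1%:R) x y - (x == y)%:R)) @[m --> \oo] --> h * Q x y.
Proof.
move=> h0 Sx Sy; have [_ _ _ _ /(_ _ _ Sx Sy)] := tf.
move=> /cvg_at_rightP /(_ (fun m => h / m.+1%:R)) dP.
have {}dP := dP _.
have /dP /(cvgMl_tmp (a := h)) : (forall n, (h / n.+1%:R > 0)%R) /\
    h / n.+1%:R @[n --> \oo] --> 0.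
  split; first by move=> m; rewrite divr_gt0.
  by rewrite -(mulr0 h); apply: cvgMl_tmp; exact: cvg_harmonic.
apply: cvg_trans; apply: near_eq_cvg; apply: nearW => m /=.
by rewrite invf_div mulrA [X in X * _]mulrC divfK ?gt_eqF//.
Qed.

(** By subadditivity the exit probability over [h] is at most [m.+1] times that over [h / m.+1], and
    this product tends to [- (h * Q x x)]. *)
Lemma exit_le (h : R) x : 0 <= h -> S x -> 1 - P h x x <= c * h.
Proof.
rewrite le_eqVlt => /predU1P[<- Sx|h0 Sx]; first by rewrite P_0// eqxx subrr mulr0.
have /cvgN Pcvg := transition_cvg h x x h0 Sx Sx.
apply: (@le_trans _ _ (- (h * Q x x))); last first.
  by rewrite -mulrN mulrC ler_wpM2r ?Qc// ltW.
apply: (cvgr_to_ge Pcvg); apply: nearW => m; rewrite eqxx -mulrN opprB.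
have := exit_natmul (h / m.+1%:R) x m.+1 _ Sx.
by rewrite [_ * (h / _)]mulrC divfK//; apply; rewrite divr_ge0// ltW.
Qed.

Let off_diagonal_le (h : R) x y : 0 <= h -> S x -> S y -> x != y ->
  P h x x + P h x y <= 1.
Proof.
move=> h0 Sx Sy xy; rewrite -lee_fin -(P_sum h x)//.
have := @le_esum_seq R T S (P h x) [:: x; y].
rewrite big_cons big_seq1; apply.
- by rewrite /= inE xy.
- by move=> z; rewrite !inE => /orP[] /eqP ->.
- by move=> z Sz; exact: P_ge0.
Qed.

(** Chapman-Kolmogorov is truncated to the intermediate states [x] and [y]. The mass elsewhere is at
    most [c * s] and reaches [y] with probability at most [c * t]; every other error term is also a
    product of a factor at most [c * s] and one at most [c * t]. *)
Lemma transition_second_difference (s t : R) x y : 0 <= s -> 0 <= t ->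
  S x -> S y ->
  `|P (s + t) x y - P s x y - P t x y + (x == y)%:R| <= 2 * c ^+ 2 * s * t.
Proof.
move=> s0 t0 Sx Sy.
have c0 : 0 <= c * t by exact: le_trans (exit_ge0 t x t0 Sx) (exit_le t x t0 Sx).
have Pb x' : S x' -> x' != y -> P t x' y <= c * t.
  move=> Sx' x'y; apply: le_trans (exit_le t x' t0 Sx').
  by rewrite lerBrDl off_diagonal_le.
have [as_ at_] := (exit_ge0 s x s0 Sx, exit_le s x s0 Sx).
have [bs bt] := (exit_ge0 t y t0 Sy, exit_le t y t0 Sy).
have := ler_pM as_ bs at_ bt.
have := ler_wpM2l c0 at_; have := mulr_ge0 as_ bs.
have [xy|xy] := eqVneq x y.
  rewrite -{}xy in Pb bs bt *.
  have [||_ + +] := @chapman_bounds [:: x] s t (c * t) x x isT _ s0 t0 Sx Sx c0.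
  - by move=> x'; rewrite inE => /eqP ->.
  - by move=> x' Sx'; rewrite inE; exact: Pb.
  rewrite !big_seq1 mulr1n => ? ? ? ? ?; rewrite ler_norml; apply/andP; split; lra.
have [|||+ + +] := @chapman_bounds [:: x; y] s t (c * t) x y _ _ s0 t0 Sx Sy c0.
- by rewrite /= inE xy.
- by move=> x'; rewrite !inE => /orP[] /eqP ->.
- by move=> x' Sx'; rewrite !inE negb_or => /andP[_]; exact: Pb.
rewrite !big_cons !big_nil !addr0 => le1 lo hi ? ? ?.
have e0 := P_ge0 s x y s0 Sx Sy; have f0 := P_ge0 t x y t0 Sx Sy.
have fle := Pb x Sx xy.
have ele := le_trans (_ : P s x y <= 1 - P s x x) at_.
have {}ele : P s x y <= c * s by apply: ele; rewrite lerBrDl.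
have := ler_pM as_ f0 at_ fle; have := ler_pM e0 bs ele bt.
have := mulr_ge0 as_ f0; have := mulr_ge0 e0 bs.
have := mulr_ge0 c0 e0.
by rewrite ler_norml => ? ? ? ? ?; apply/andP; split; lra.
Qed.

(** One more step of length [t] after [m] steps adds a second difference, at most
    [2 * c ^+ 2 * (m%:R * t) * t]; these increments sum to at most the stated square. *)
Lemma transition_multiple_bound (t : R) m x y : 0 <= t -> S x -> S y ->
  `|P (m%:R * t) x y - (x == y)%:R - m%:R * (P t x y - (x == y)%:R)|
    <= 2 * c ^+ 2 * (m%:R * t) ^+ 2.
Proof.
move=> t0 Sx Sy; elim: m => [|m IHm].
  by rewrite !mul0r P_0// subrr subr0 normr0 expr0n mulr0.
have m0 : 0 <= m%:R :> R by [].
have := transition_second_difference (m%:R * t) t x y (mulr_ge0 m0 t0) t0 Sx Sy.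
rewrite -[m.+1%:R]natr1; set mm := m%:R in IHm m0 *; rewrite (mulrDl mm 1 t) mul1r => H.
have -> : P (mm * t + t) x y - (x == y)%:R - (mm + 1) * (P t x y - (x == y)%:R) =
  (P (mm * t) x y - (x == y)%:R - mm * (P t x y - (x == y)%:R)) +
  (P (mm * t + t) x y - P (mm * t) x y - P t x y + (x == y)%:R) by ring.
apply: (le_trans (ler_normD _ _)); apply: (le_trans (lerD IHm H)).
rewrite -subr_ge0.
have -> : 2 * c ^+ 2 * (mm * t + t) ^+ 2 -
  (2 * c ^+ 2 * (mm * t) ^+ 2 + 2 * c ^+ 2 * (mm * t) * t) =
  2 * c ^+ 2 * t ^+ 2 * (mm + 1) by ring.
apply: mulr_ge0; last exact: addr_ge0.
by do 2![apply: mulr_ge0; last exact: sqr_ge0].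
Qed.

(** Apply the previous bound to [m.+1] steps of length [h / m.+1]: its right side does not depend on
    [m], and as [m] grows the scaled difference tends to [h * Q x y]. *)
Lemma transition_taylor (h : R) x y : 0 <= h -> S x -> S y ->
  `|P h x y - (x == y)%:R - h * Q x y| <= 2 * c ^+ 2 * h ^+ 2.
Proof.
rewrite le_eqVlt => /predU1P[<-|h0] Sx Sy.
  by rewrite P_0// subrr mul0r subr0 normr0 expr0n mulr0.
have /(cvgB (cvg_cst (P h x y - (x == y)%:R))) /cvg_norm Pcvg :=
  transition_cvg h x y h0 Sx Sy.
apply: (cvgr_to_le Pcvg); apply: nearW => m.
have := transition_multiple_bound (h / m.+1%:R) m.+1 x y _ Sx Sy.
by rewrite [_ * (h / _)]mulrC divfK//; apply; rewrite divr_ge0// ltW.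
Qed.

End SecondOrder.

(** * Reindexing and limits of finite sums *)

Section SeqSums.
Context (R : realType).

Lemma sum_eq_mem (T : eqType) (F : seq T) (x : T) (f : T -> R) :
  uniq F -> x \in F -> \sum_(y <- F) (x == y)%:R * f y = f x.
Proof.
move=> uF xF; rewrite (bigD1_seq x)//= eqxx mul1r big1 ?addr0// => y yx.
by rewrite eq_sym (negPf yx) mul0r.
Qed.

Lemma big_seq_widen (T : eqType) (F F' : seq T) (f : T -> R) : uniq F -> uniq F' ->
  {subset F <= F'} -> (forall y, y \in F' -> y \notin F -> f y = 0) ->
  \sum_(y <- F) f y = \sum_(y <- F') f y.
Proof.
move=> uF uF' FF' f0; rewrite [RHS](bigID (mem F))/= [X in _ + X]big_seq_cond.
rewrite [X in _ + X]big1 ?addr0; last by move=> y /andP[/f0].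
rewrite -[RHS]big_filter; apply: perm_big; apply: uniq_perm => //.
  exact: filter_uniq.
by move=> y; rewrite mem_filter; case: (boolP (y \in F)) => // /FF' ->.
Qed.

Lemma cvg_sum_seq (U : eqType) (r : seq U) (f : U -> R -> R) (a : U -> R)
    (F : set_system R) : Filter F ->
  (forall u, u \in r -> f u h @[h --> F] --> a u) ->
  \sum_(u <- r) f u h @[h --> F] --> \sum_(u <- r) a u.
Proof.
move=> FF; elim: r => [_|u r IHr ur].
  by under eq_fun do rewrite big_nil; rewrite big_nil; exact: cvg_cst.
under eq_fun do rewrite big_cons; rewrite big_cons.
apply: cvgD; first by apply: ur; rewrite mem_head.
by apply: IHr => v vr; apply: ur; rewrite inE vr orbT.
Qed.

End SeqSums.

(** * Image of a Markov process under a map with finite fibers and an intertwining *)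

Section Intertwining.
Context (R : realType) (T V : countType) (S : set T) (W : set V) (b : T -> V)
  (fib : V -> seq T) (L : T -> R) (Q : T -> T -> R) (Q' : V -> V -> R)
  (nbr : T -> seq T) (B : nat) (c : R).

Hypothesis bS : forall x, S x -> W (b x).
Hypothesis fib_uniq : forall z, uniq (fib z).
Hypothesis fibP : forall z x, x \in fib z <-> S x /\ b x = z.
Hypothesis L_ge0 : forall x, S x -> 0 <= L x.
Hypothesis L_sum : forall z, W z -> \sum_(x <- fib z) L x = 1.
Hypothesis nbr_uniq : forall x, S x -> uniq (nbr x).
Hypothesis nbr_sub : forall x y, S x -> y \in nbr x -> S y.
Hypothesis nbr_self : forall x, S x -> x \in nbr x.
Hypothesis nbr_size : forall x, S x -> (size (nbr x) <= B)%N.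
Hypothesis nbr_out : forall x y, S x -> S y -> y \notin nbr x -> Q x y = 0.
Hypothesis nbr_sum : forall x, S x -> \sum_(y <- nbr x) Q x y = 0.
Hypothesis Q_le : forall x y, S x -> S y -> `|Q x y| <= c.
Hypothesis QL : forall z y, W z -> S y ->
  \sum_(x <- fib z) L x * Q x y = Q' z (b y) * L y.

Lemma fiberS z x : x \in fib z -> S x.
Proof. by move=> /fibP[]. Qed.

Lemma sum_fibers (F : seq T) (N : seq V) (f : T -> R) : uniq F ->
  (forall y, y \in F -> S y) -> uniq N -> {subset map b F <= N} ->
  (forall y, S y -> y \notin F -> f y = 0) ->
  \sum_(y <- F) f y = \sum_(z <- N) \sum_(y <- fib z) f y.
Proof.
move=> uF FS uN FN f0.
transitivity (\sum_(z <- N) \sum_(y <- F) (b y == z)%:R * f y).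
  rewrite exchange_big /= [LHS]big_seq [RHS]big_seq; apply: eq_bigr => y yF.
  by rewrite sum_eq_mem//; apply: FN; exact: map_f.
apply: eq_bigr => z _; rewrite (bigID (fun y => b y == z))/= [X in _ + X]big1; last first.
  by move=> y /negPf ->; rewrite mul0r.
rewrite addr0 (eq_bigr f); last by move=> y ->; rewrite mul1r.
rewrite -big_filter; apply: big_seq_widen => //; first exact: filter_uniq.
  by move=> y; rewrite mem_filter => /andP[/eqP yz /FS Sy]; apply/fibP.
move=> y /fibP[Sy yz]; rewrite mem_filter yz eqxx; exact: f0.
Qed.

Lemma L_sum_fiber z (f : R) : W z -> \sum_(x <- fib z) L x * f = f.
Proof. by move=> Wz; rewrite -mulr_suml L_sum ?mul1r. Qed.

Lemma L_average_le z (f : T -> R) (k : R) : W z ->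
  (forall x, S x -> `|f x| <= k) -> `|\sum_(x <- fib z) L x * f x| <= k.
Proof.
move=> Wz fk; rewrite -[leRHS](L_sum_fiber z k Wz).
apply: (le_trans (ler_norm_sum _ _ _)); rewrite big_seq [leRHS]big_seq.
apply: ler_sum => x /fiberS Sx; rewrite normrM ger0_norm ?L_ge0//.
by rewrite ler_wpM2l ?L_ge0 ?fk.
Qed.

(** The images of all targets of [Q] from the fiber of [z]: the finite list over which sums against
    the row [Q' z] are taken. *)
Definition image_nbr z := undup [seq b y | x <- fib z, y <- nbr x].

Lemma sum_image_nbr z x (f : T -> R) : x \in fib z ->
  (forall y, S y -> y \notin nbr x -> f y = 0) ->
  \sum_(y <- nbr x) f y = \sum_(z' <- image_nbr z) \sum_(y <- fib z') f y.
Proof.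
move=> xz f0; have Sx := fiberS _ _ xz.
apply: sum_fibers; [exact: nbr_uniq|by move=> y; exact: nbr_sub|exact: undup_uniq| |by []].
move=> _ /mapP[y yx ->]; rewrite mem_undup; apply/allpairsPdep.
by exists x, y.
Qed.

Lemma image_nbrW z z' : z' \in image_nbr z -> W z'.
Proof.
rewrite mem_undup => /allpairsPdep[x [y [/fiberS Sx yx ->]]].
by apply: bS; exact: nbr_sub yx.
Qed.

(** By [QL], [Q' z z'] is the [L]-average over the fiber of [z] of the total rate into the fiber of
    [z']. So its absolute row sum is controlled by those of [Q], which have at most [B] terms of
    size at most [c]. *)
Lemma image_rate_le z : W z -> \sum_(z' <- image_nbr z) `|Q' z z'| <= B%:R * c.
Proof.
move=> Wz; apply: (@le_trans _ _ (\sum_(z' <- image_nbr z)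
    \sum_(x <- fib z) L x * \sum_(y <- fib z') `|Q x y|)).
  rewrite big_seq [leRHS]big_seq; apply: ler_sum => z' z'N.
  have Wz' := image_nbrW _ _ z'N.
  have -> : Q' z z' = \sum_(y <- fib z') \sum_(x <- fib z) L x * Q x y.
    rewrite -(L_sum_fiber z' (Q' z z'))// big_seq [RHS]big_seq.
    by apply: eq_bigr => y /fibP[Sy <-]; rewrite QL// mulrC.
  rewrite exchange_big /=; apply: (le_trans (ler_norm_sum _ _ _)).
  rewrite big_seq [leRHS]big_seq; apply: ler_sum => x /fiberS Sx.
  rewrite -mulr_sumr normrM ger0_norm ?L_ge0// ler_wpM2l ?L_ge0//.
  exact: ler_norm_sum.
rewrite exchange_big /=; under eq_bigr do rewrite -mulr_sumr.
rewrite (eq_big_seq (fun x => L x * \sum_(y <- nbr x) `|Q x y|)); last first.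
  move=> x xz; congr (_ * _); rewrite [RHS](sum_image_nbr z x)// => y Sy yx.
  by rewrite nbr_out ?normr0//; exact: fiberS xz.
apply: (le_trans (ler_norm _)); apply: L_average_le => // x Sx.
rewrite ger0_norm ?sumr_ge0//.
apply: (@le_trans _ _ (\sum_(y <- nbr x) c)).
  rewrite big_seq [leRHS]big_seq; apply: ler_sum => y yx.
  by apply: Q_le => //; exact: nbr_sub yx.
rewrite big_const_seq count_predT iter_addr_0 -(mulr_natl c).
have c0 : 0 <= c by exact: le_trans (normr_ge0 _) (Q_le x x Sx Sx).
by rewrite ler_wpM2r// ler_nat nbr_size.
Qed.

Section Kernel.
Variable P : R -> T -> T -> R.
Hypothesis tf : transition_function S Q P.

Let P_ge0 (t : R) x y : 0 <= t -> S x -> S y -> 0 <= P t x y.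
Proof. by case: tf => + _ _ _ _; exact. Qed.

Let Qc x : S x -> - Q x x <= c.
Proof. by move=> Sx; rewrite (le_trans _ (Q_le x x Sx Sx))// -normrN ler_norm. Qed.

Let K : R := 4 * c ^+ 2 * B%:R.

(** The first step, of length [h], is expanded by [transition_taylor] over the neighbours of [x].
    The Taylor error counts twice, in the truncated Chapman-Kolmogorov sum and in the mass missing
    from it, whence the 4 in [K]. *)
Lemma backward_bound (t h : R) x y : 0 <= t -> 0 <= h -> S x -> S y ->
  `|P (h + t) x y - P t x y - h * \sum_(x' <- nbr x) Q x x' * P t x' y|
    <= K * h ^+ 2.
Proof.
move=> t0 h0 Sx Sy.
have nS x' : x' \in nbr x -> S x' by exact: nbr_sub.
have := @chapman_bounds R T S Q P tf (nbr x) h t 1 x y (nbr_uniq x Sx) nS h0 t0 Sx Sy ler01.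
move=> /(_ (fun x' Sx' _ => transition_le1 _ _ _ _ _ tf t x' y t0 Sx' Sy)).
pose e x' := P h x x' - (x == x')%:R - h * Q x x'.
have eP x' : P h x x' = (x == x')%:R + h * Q x x' + e x' by rewrite /e; ring.
have e_le x' : x' \in nbr x -> `|e x'| <= 2 * c ^+ 2 * h ^+ 2.
  by move=> x'x; apply: (transition_taylor _ _ _ _ _ _ tf Qc) => //; exact: nS.
clearbody e.
have -> : \sum_(x' <- nbr x) P h x x' = 1 + \sum_(x' <- nbr x) e x'.
  under eq_bigr do rewrite eP.
  rewrite !big_split /= -mulr_sumr nbr_sum// mulr0 addr0.
  congr (_ + _); rewrite -[RHS](@sum_eq_mem R T (nbr x) x (fun=> 1)) ?nbr_uniq ?nbr_self//.
  by apply: eq_bigr => x' _; rewrite mulr1.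
have -> : \sum_(x' <- nbr x) P h x x' * P t x' y = P t x y +
    h * \sum_(x' <- nbr x) Q x x' * P t x' y + \sum_(x' <- nbr x) e x' * P t x' y.
  under eq_bigr do rewrite eP !mulrDl.
  rewrite !big_split /= sum_eq_mem ?nbr_uniq ?nbr_self// mulr_sumr.
  by congr (_ + _ + _); apply: eq_bigr => x' _; rewrite mulrA.
have E (g : T -> R) : (forall x', S x' -> `|g x'| <= 1) ->
    `|\sum_(x' <- nbr x) e x' * g x'| <= 2 * c ^+ 2 * B%:R * h ^+ 2.
  move=> g1; apply: (le_trans (ler_norm_sum _ _ _)).
  apply: (@le_trans _ _ (\sum_(x' <- nbr x) 2 * c ^+ 2 * h ^+ 2)).
    rewrite big_seq [leRHS]big_seq; apply: ler_sum => x' x'x.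
    rewrite normrM -[leRHS]mulr1; apply: ler_pM => //; first exact: e_le.
    by apply: g1; exact: nS.
  rewrite big_const_seq count_predT iter_addr_0 -(mulr_natr (2 * c ^+ 2 * h ^+ 2)) [leRHS]mulrAC.
  rewrite ler_wpM2l ?ler_nat ?nbr_size//.
  by do 2![apply: mulr_ge0; last exact: sqr_ge0].
have := E (fun=> 1) (fun _ _ => ltac:(rewrite normr1; exact: lexx)).
have := E (P t ^~ y) (fun x' Sx' => ltac:(rewrite ger0_norm ?P_ge0//;
  exact: (transition_le1 _ _ _ _ _ tf))).
under [X in _ -> `|X| <= _ -> _]eq_bigr do rewrite mulr1.
move: (\sum_(x' <- nbr x) e x') => s; move: (\sum_(x' <- nbr x) e x' * _) => s'.
rewrite /K !ler_norml => /andP[? ?] /andP[? ?] [? ? ?].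
apply/andP; split; lra.
Qed.

Let G (t : R) z y := \sum_(x <- fib z) L x * P t x y.

(** The [L]-average of [backward_bound] over the fiber of [z], where [QL] replaces [Q] by [Q']: [G]
    solves the backward equation of [Q'] up to order [h ^+ 2]. *)
Lemma averaged_backward_bound (t h : R) z y : 0 <= t -> 0 <= h -> W z -> S y ->
  `|G (h + t) z y - G t z y - h * \sum_(z' <- image_nbr z) Q' z z' * G t z' y|
    <= K * h ^+ 2.
Proof.
move=> t0 h0 Wz Sy.
have -> : \sum_(z' <- image_nbr z) Q' z z' * G t z' y =
    \sum_(x <- fib z) L x * \sum_(x' <- nbr x) Q x x' * P t x' y.
  transitivity (\sum_(x <- fib z) L x * \sum_(z' <- image_nbr z)
      \sum_(x' <- fib z') Q x x' * P t x' y); last first.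
    rewrite big_seq [RHS]big_seq; apply: eq_bigr => x xz.
    rewrite [in RHS](sum_image_nbr z x)// => y' Sy' y'x.
    by rewrite nbr_out ?mul0r//; exact: fiberS xz.
  under [RHS]eq_bigr do rewrite mulr_sumr.
  rewrite exchange_big /=; apply: eq_bigr => z' _.
  under [RHS]eq_bigr do rewrite mulr_sumr.
  rewrite exchange_big /= mulr_sumr big_seq [RHS]big_seq.
  apply: eq_bigr => x' /fibP[Sx' <-].
  by rewrite mulrA -QL// mulr_suml; apply: eq_bigr => x _; rewrite mulrA.
rewrite mulr_sumr /G -!sumrB.
under eq_bigr do rewrite mulrCA -!mulrBr.
by apply: L_average_le => // x Sx; exact: backward_bound.
Qed.

Lemma averaged_0 z y : W z -> S y -> G 0 z y = (b y == z)%:R * L y.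
Proof.
move=> Wz Sy; have P0 x : x \in fib z -> P 0 x y = (y == x)%:R.
  by move=> /fiberS Sx; case: tf => _ _ -> //; rewrite eq_sym.
rewrite /G (eq_big_seq (fun x => (y == x)%:R * L x)); last first.
  by move=> x /P0 ->; rewrite mulrC.
case: (eqVneq (b y) z) => [yz|yz].
  by rewrite sum_eq_mem// ?mul1r//; apply/fibP.
rewrite big_seq big1 ?mul0r// => x /fibP[_ xz].
by case: eqVneq => [yx|]; [rewrite yx xz eqxx in yz|rewrite mul0r].
Qed.

Let ler_norm_scale (a x k : R) : 0 <= a -> `|x| <= k -> `|a * x| <= a * k.
Proof. by move=> a0 xk; rewrite normrM ger0_norm// ler_wpM2l. Qed.

(** The cross product that vanishes when [G t z] is proportional to [L] on the pair [y1], [y2]. *)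
Let E y1 y2 (t : R) z := L y2 * G t z y1 - L y1 * G t z y2.

Lemma defect_step y1 y2 (t h eps : R) : 0 <= t -> 0 <= h -> S y1 -> S y2 ->
  (forall z, W z -> `|E y1 y2 t z| <= eps) -> forall z, W z ->
  `|E y1 y2 (h + t) z| <= (1 + h * (B%:R * c)) * eps + K * (L y1 + L y2) * h ^+ 2.
Proof.
move=> t0 h0 S1 S2 Eeps z Wz.
have H1 := averaged_backward_bound t h z y1 t0 h0 Wz S1.
have H2 := averaged_backward_bound t h z y2 t0 h0 Wz S2.
have {}H1 := ler_norm_scale _ _ _ (L_ge0 _ S2) H1.
have {}H2 := ler_norm_scale _ _ _ (L_ge0 _ S1) H2.
have eps0 : 0 <= eps by exact: le_trans (normr_ge0 _) (Eeps z Wz).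
have QE : `|\sum_(z' <- image_nbr z) Q' z z' * E y1 y2 t z'| <= B%:R * c * eps.
  apply: (le_trans (ler_norm_sum _ _ _)).
  apply: le_trans (ler_wpM2r eps0 (image_rate_le z Wz)); rewrite mulr_suml.
  rewrite big_seq [leRHS]big_seq; apply: ler_sum => z' /image_nbrW Wz'.
  by rewrite normrM ler_wpM2l// Eeps.
have QEE : \sum_(z' <- image_nbr z) Q' z z' * E y1 y2 t z' =
    L y2 * (\sum_(z' <- image_nbr z) Q' z z' * G t z' y1) -
    L y1 * (\sum_(z' <- image_nbr z) Q' z z' * G t z' y2).
  by rewrite !mulr_sumr -sumrB; apply: eq_bigr => z' _; rewrite /E; ring.
have {}QE := ler_norm_scale _ _ _ h0 QE.
have := Eeps z Wz; rewrite QEE in QE; move: H1 H2 QE.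
rewrite /E; move: (\sum_(z' <- _) _) => s1; move: (\sum_(z' <- _) _) => s2.
rewrite !ler_norml => /andP[? ?] /andP[? ?] /andP[? ?] /andP[? ?].
by apply/andP; split; lra.
Qed.

(** Discrete Gronwall: [E] vanishes at time 0 because [b y1 = b y2]; each step multiplies the bound
    by [1 + h * (B%:R * c)], at most [expR (h * (B%:R * c))], and adds a term of order [h ^+ 2]. *)
Lemma defect_bound y1 y2 (h : R) m z : 0 <= h -> S y1 -> S y2 -> b y1 = b y2 -> W z ->
  `|E y1 y2 (m%:R * h) z| <=
    m%:R * (K * (L y1 + L y2) * h ^+ 2) * expR (m%:R * (h * (B%:R * c))).
Proof.
move=> h0 S1 S2 b12; elim: m z => [|m IHm] z Wz.
  rewrite !mul0r /E !averaged_0// b12 [_ * (_ * L y2)]mulrCA [L y2 * _]mulrCA.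
  by rewrite [L y2 * _]mulrC subrr normr0.
have c0 : 0 <= c by exact: le_trans (normr_ge0 _) (Q_le y1 y1 S1 S1).
have mS (x : R) : m.+1%:R * x = x + m%:R * x by rewrite -natr1 mulrDl mul1r addrC.
rewrite !mS expRD.
have m0 : 0 <= m%:R * h :> R by rewrite mulr_ge0.
apply: (le_trans (defect_step _ _ _ _ _ m0 h0 S1 S2 IHm _ Wz)).
set C := h * (B%:R * c); set e := expR (m%:R * C).
set k := K * _ * _; set f := expR C.
have C0 : 0 <= C by rewrite !mulr_ge0.
have k0 : 0 <= k.
  by apply: mulr_ge0 (sqr_ge0 _); apply: mulr_ge0; rewrite ?addr_ge0 ?L_ge0// /K !mulr_ge0 ?sqr_ge0.
have fC : 1 + C <= f := expR_ge1Dx C.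
have e1 : 1 <= e by rewrite -expR0 ler_expR mulr_ge0.
rewrite [leLHS]addrC (mulrDl k); apply: lerD.
  rewrite -[leLHS]mulr1 ler_wpM2l// mulr_ege1// (le_trans _ fC)// lerDl//.
rewrite mulrCA; apply: ler_wpM2l; first exact: mulr_ge0.
by apply: ler_wpM2r => //; exact: le_trans e1.
Qed.

(** With [m.+1] steps of length [t / m.+1] the bound of [defect_bound] becomes [k / m.+1], which
    tends to 0. *)
Lemma averaged_ratio y1 y2 (t : R) z : 0 <= t -> S y1 -> S y2 -> b y1 = b y2 ->
  W z -> L y2 * G t z y1 = L y1 * G t z y2.
Proof.
move=> t0 S1 S2 b12 Wz; apply/eqP; rewrite -subr_eq0 -normr_le0.
pose k := K * (L y1 + L y2) * t ^+ 2 * expR (t * (B%:R * c)).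
have : k * m.+1%:R^-1 @[m --> \oo] --> (0 : R).
  by rewrite -(mulr0 k); apply: cvgMl_tmp; exact: cvg_harmonic.
move=> /cvgr_to_ge; apply; apply: nearW => m.
have mt : m.+1%:R * (t / m.+1%:R) = t by rewrite mulrC divfK.
have := defect_bound y1 y2 (t / m.+1%:R) m.+1 z _ S1 S2 b12 Wz.
rewrite divr_ge0// mt [m.+1%:R * (_ * (B%:R * c))]mulrA mt => /(_ isT) /le_trans.
apply; rewrite le_eqVlt; apply/orP; left; apply/eqP.
by rewrite /k; field; rewrite ?nat1r ?natr1 pnatr_eq0.
Qed.

(** The candidate semigroup of [Q']: start with law [L] on the fiber of [z], end anywhere in the
    fiber of [z']. *)
Definition image_transition (t : R) z z' := \sum_(y <- fib z') G t z y.
Let P' := image_transition.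

(** Summing [averaged_ratio] over the fiber of [b y], on which [L] has total mass 1, makes the
    proportionality factor explicit. *)
Lemma averaged_factor (t : R) z y : 0 <= t -> W z -> S y ->
  G t z y = L y * P' t z (b y).
Proof.
move=> t0 Wz Sy; rewrite /P' /image_transition mulr_sumr.
rewrite -[LHS](L_sum_fiber (b y))//; last exact: bS.
by apply: eq_big_seq => y' /fibP[Sy' y'y]; apply: averaged_ratio.
Qed.

(** A finite set of states meets finitely many fibers, and finitely many fibers form a finite set;
    so the suprema of finite sums on the two sides agree. *)
Lemma esum_fibers (f : T -> R) : (forall y, S y -> 0 <= f y) ->
  \esum_(y in S) (f y)%:E = \esum_(z in W) (\sum_(y <- fib z) f y)%:E.
Proof.
move=> f0.
have ff0 z : 0 <= \sum_(y <- fib z) f y.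
  by rewrite big_seq sumr_ge0// => y /fiberS /f0.
apply/eqP; rewrite eq_le; apply/andP; split; apply: esum_le => F uF FS.
  pose g y := if y \in F then f y else 0.
  have FW z : z \in undup (map b F) -> W z.
    by rewrite mem_undup => /mapP[y /FS Sy ->]; exact: bS.
  apply: le_trans (le_esum_seq _ _ W _ (undup (map b F)) (undup_uniq _) FW _) => //.
  rewrite lee_fin (eq_big_seq g); last by move=> y yF; rewrite /g yF.
  rewrite (sum_fibers F (undup (map b F)))//; first last.
  - by move=> y _ /negPf yF; rewrite /g yF.
  - by move=> z; rewrite mem_undup.
  - exact: undup_uniq.
  apply: ler_sum => z _; rewrite big_seq [leRHS]big_seq; apply: ler_sum => y /fiberS.
  by rewrite /g; case: ifP => // _ /f0.
pose D := undup (flatten (map fib F)).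
have DS y : y \in D -> S y.
  by rewrite mem_undup => /flatten_mapP[z _ /fiberS].
apply: le_trans (le_esum_seq _ _ S _ D (undup_uniq _) DS f0); rewrite lee_fin.
pose g y := if y \in D then f y else 0.
rewrite [leRHS](eq_big_seq g); last by move=> y yD; rewrite /g yD.
rewrite (sum_fibers D F)//; first last.
- by move=> y _ /negPf yD; rewrite /g yD.
- by move=> _ /mapP[y + ->]; rewrite mem_undup => /flatten_mapP[z' z'F /fibP[_ ->]].
- exact: undup_uniq.
rewrite big_seq [leRHS]big_seq le_eqVlt; apply/orP; left; apply/eqP.
apply: eq_bigr => z zF; apply: eq_big_seq => y yz.
by rewrite /g mem_undup; case: ifP => // /flatten_mapP[]; exists z.
Qed.

Let P'_ge0 (t : R) z z' : 0 <= t -> 0 <= P' t z z'.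
Proof.
move=> t0; rewrite /P' /image_transition big_seq sumr_ge0// => y /fiberS Sy.
rewrite /G big_seq sumr_ge0// => x /fiberS Sx.
by rewrite mulr_ge0 ?L_ge0 ?P_ge0.
Qed.

Let G_ge0 (t : R) z y : 0 <= t -> S y -> 0 <= G t z y.
Proof.
move=> t0 Sy; rewrite /G big_seq sumr_ge0// => x /fiberS Sx.
by rewrite mulr_ge0 ?L_ge0 ?P_ge0.
Qed.

Lemma esum_averaged (t : R) z (f : T -> R) (I : T -> R) : 0 <= t ->
  (forall y, S y -> 0 <= f y) ->
  (forall x, S x -> (I x)%:E = \esum_(y in S) (P t x y * f y)%:E) ->
  (\sum_(x <- fib z) L x * I x)%:E = \esum_(y in S) (G t z y * f y)%:E.
Proof.
move=> t0 f0 IE.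
have -> : \esum_(y in S) (G t z y * f y)%:E =
    \esum_(y in S) (\sum_(x <- fib z | x \in fib z) (L x * (P t x y * f y))%:E)%E.
  apply: eq_esum => y Sy; rewrite /G mulr_suml big_seq sumEFin.
  by congr EFin; apply: eq_bigr => x _; rewrite mulrA.
rewrite esum_sum => [|y x Sy /fiberS Sx]; last first.
  by rewrite lee_fin !mulr_ge0 ?L_ge0 ?P_ge0 ?f0.
rewrite big_seq -sumEFin; apply: eq_bigr => x /fiberS Sx.
rewrite esumZl ?L_ge0// => [|y Sy]; last by rewrite mulr_ge0 ?P_ge0 ?f0.
by rewrite EFinM IE.
Qed.

Lemma image_transition_function : transition_function W Q' P'.
Proof.
have [_ P1 P0 PD dP] := tf; split.
- by move=> t z z' t0 _ _; exact: P'_ge0.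
- move=> t z t0 Wz; rewrite -(L_sum z Wz) -esum_fibers; last first.
    by move=> y Sy; exact: G_ge0.
  have := esum_averaged t z (fun=> 1) (fun=> 1) t0 (fun _ _ => ler01) _.
  under eq_bigr do rewrite mulr1.
  move=> -> //; first by apply: eq_esum => y _; rewrite mulr1.
  by move=> x Sx; rewrite -(P1 t x)//; apply: eq_esum => y _; rewrite mulr1.
- move=> z z' Wz Wz'; rewrite /P' /image_transition.
  rewrite (eq_big_seq (fun y => (z == z')%:R * L y)); last first.
    by move=> y /fibP[Sy yz]; rewrite averaged_0// yz eq_sym.
  by rewrite -mulr_sumr L_sum// mulr1.
- move=> s t z z'' s0 t0 Wz Wz''.
  pose f x := \sum_(y <- fib z'') P t x y.
  have f0 x : S x -> 0 <= f x.
    by move=> Sx; rewrite /f big_seq sumr_ge0// => y /fiberS Sy; exact: P_ge0.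
  have := esum_averaged s z f (fun x => \sum_(y <- fib z'') P (s + t) x y) s0 f0 _.
  have -> : \sum_(x <- fib z) L x * (\sum_(y <- fib z'') P (s + t) x y) =
      P' (s + t) z z''.
    rewrite /P' /image_transition exchange_big /=.
    by apply: eq_bigr => x _; rewrite mulr_sumr.
  move=> ->; last first.
    move=> x Sx; have -> : \esum_(y in S) (P s x y * f y)%:E =
        \esum_(y in S) (\sum_(y' <- fib z'' | y' \in fib z'') (P s x y * P t y y')%:E)%E.
      by apply: eq_esum => y Sy; rewrite /f mulr_sumr big_seq sumEFin.
    rewrite esum_sum => [|y y' Sy /fiberS Sy']; last first.
      by rewrite lee_fin mulr_ge0 ?P_ge0.
    by rewrite big_seq -sumEFin; apply: eq_bigr => y /fiberS Sy; exact: PD.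
  rewrite esum_fibers; last by move=> y Sy; rewrite mulr_ge0 ?G_ge0 ?f0.
  apply: eq_esum => z' Wz'; congr EFin.
  (* By the factorization, the state at time [s] has law [L] given its image [z'], so the second leg
     starts from the very law that defines [P' t z']. *)
  rewrite (eq_big_seq (fun x => P' s z z' * (L x * f x))); last first.
    by move=> x /fibP[Sx <-]; rewrite averaged_factor//; ring.
  rewrite -mulr_sumr; congr (_ * _); rewrite /P' /image_transition exchange_big /=.
  by apply: eq_bigr => x _; rewrite mulr_sumr.
- move=> z z' Wz Wz'.
  (* [Q' z z'] is a finite double sum of entries of [Q], each the derivative of the matching entry
     of [P]. *)
  have -> : Q' z z' = \sum_(y <- fib z') \sum_(x <- fib z) L x * Q x y.
    rewrite (eq_big_seq (fun y => Q' z z' * L y)); last first.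
      by move=> y /fibP[Sy <-]; rewrite QL.
    by rewrite -mulr_sumr L_sum// mulr1.
  have : \sum_(y <- fib z') \sum_(x <- fib z) L x * (h^-1 * (P h x y - (x == y)%:R))
      @[h --> 0^'+] --> \sum_(y <- fib z') \sum_(x <- fib z) L x * Q x y.
    apply: cvg_sum_seq => y /fiberS Sy; apply: cvg_sum_seq => x /fiberS Sx.
    by apply: cvgMl_tmp; exact: dP.
  apply: cvg_trans; apply: near_eq_cvg; near=> h.
  have -> : (z == z')%:R = \sum_(y <- fib z') G 0 z y.
    rewrite (eq_big_seq (fun y => (z == z')%:R * L y)); last first.
      by move=> y /fibP[Sy yz]; rewrite averaged_0// yz eq_sym.
    by rewrite -mulr_sumr L_sum// mulr1.
  rewrite /P' /image_transition -sumrB mulr_sumr.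
  apply: eq_big_seq => y /fiberS Sy; rewrite /G -sumrB mulr_sumr.
  by apply: eq_big_seq => x /fiberS Sx; rewrite P0// mulrCA -mulrBr.
Unshelve. all: by end_near.
Qed.

(** * Conditional law of the state given the past of its image *)

Section Process.
Context (d : measure_display) (Omega : measurableType d) (Pr : probability Omega R)
  (X : R -> Omega -> T) (mu : T -> R) (z0 : V).

Hypothesis XS : forall (t : R) w, 0 <= t -> S (X t w).
Hypothesis X_meas : forall (t : R) x, 0 <= t -> measurable [set w | X t w = x].
Hypothesis X_init : forall x, S x -> Pr [set w | X 0 w = x] = (mu x)%:E.
Hypothesis X_markov : markov_property Pr S P X.
Hypothesis Wz0 : W z0.
Hypothesis muE : forall x, S x -> mu x = (b x == z0)%:R * L x.

Let p (A : set Omega) : R := fine (Pr A).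

Let PrE A : measurable A -> Pr A = (p A)%:E.
Proof. by move=> mA; rewrite /p fineK//; exact: fin_num_measure. Qed.

Let event (t : R) x := [set w | X t w = x].
Let image_event (t : R) z := [set w | b (X t w) = z].

Let measurable_mem (t : R) (r : seq T) : 0 <= t -> measurable [set w | X t w \in r].
Proof.
move=> t0; elim: r => [|x r IHr].
  by rewrite [X in measurable X](_ : _ = set0)//; apply/seteqP; split.
rewrite [X in measurable X](_ : _ = event t x `|` [set w | X t w \in r]).
  by apply: measurableU => //; exact: X_meas.
apply/seteqP; split => w /=; rewrite inE.
  by case/orP => [/eqP|]; [left|right].
by case=> [->|->]; rewrite ?eqxx ?orbT.
Qed.

Let image_eventE (t : R) z : 0 <= t -> image_event t z = [set w | X t w \in fib z].
Proof.
move=> t0; apply/seteqP; split => w /=; last by case/fibP.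
by move=> Xz; apply/fibP; split=> //; exact: XS.
Qed.

Let image_event_meas (t : R) z : 0 <= t -> measurable (image_event t z).
Proof. by move=> t0; rewrite image_eventE//; exact: measurable_mem. Qed.

Let past_event (A : Type) (f : R -> A -> set Omega) (l : seq (R * A)) : set Omega :=
  foldr (fun a B => f a.1 a.2 `&` B) setT l.

Let past_event_meas (A : Type) (f : R -> A -> set Omega) l (t : R) :
  (forall s a, 0 <= s -> measurable (f s a)) ->
  all (fun a => 0 <= a.1 <= t) l -> measurable (past_event A f l).
Proof.
move=> mf; elim: l => [_|a l IHl] /=; first exact: measurableT.
move=> /andP[/andP[a0 _] /IHl]; apply: measurableI.
exact: mf.
Qed.

Let p_split_seq D (t : R) (r : seq T) : measurable D -> 0 <= t -> uniq r ->
  p (D `&` [set w | X t w \in r]) = \sum_(x <- r) p (D `&` event t x).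
Proof.
move=> mD t0; elim: r => [|x r IHr] /=.
  rewrite big_nil (_ : _ `&` _ = set0) /p ?measure0//.
  by apply/seteqP; split => w // [].
move=> /andP[xr /IHr {}IHr]; rewrite big_cons -IHr.
have mDx : measurable (D `&` event t x) by apply: measurableI => //; exact: X_meas.
have mDr : measurable (D `&` [set w | X t w \in r]).
  by apply: measurableI => //; exact: measurable_mem.
have dis : (D `&` event t x) `&` (D `&` [set w | X t w \in r]) = set0.
  by apply/seteqP; split => // w [[_ /= ->] [_ /= xr']]; rewrite xr' in xr.
have : Pr ((D `&` event t x) `|` (D `&` [set w | X t w \in r])) =
    (Pr (D `&` event t x) + Pr (D `&` [set w | X t w \in r]))%E by exact: measureU.
rewrite !PrE//; last exact: measurableU.
rewrite -setIUr -EFinD => -[<-]; congr (p (_ `&` _)).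
apply/seteqP; split => w /=; rewrite inE.
  by case/orP => [/eqP|]; [left|right].
by case=> [->|->]; rewrite ?eqxx ?orbT.
Qed.

Let p_split D (t : R) z : measurable D -> 0 <= t ->
  p (D `&` image_event t z) = \sum_(x <- fib z) p (D `&` event t x).
Proof. by move=> mD t0; rewrite image_eventE//; exact: p_split_seq. Qed.

(** The Markov property of [X] for pasts that mix images, in [l], and states, in [l']. In the
    induction on [l], an image event is split into finitely many disjoint state events, each of
    which joins [l']. *)
Let markov_image_past l l' (t h : R) x y : 0 <= t -> 0 <= h -> S x -> S y ->
  all (fun a => 0 <= a.1 <= t) l -> all (fun a => 0 <= a.1 <= t) l' ->
  p (past_event V image_event l `&` (past_event T event l' `&` event t x) `&` event (t + h) y) =
  p (past_event V image_event l `&` (past_event T event l' `&` event t x)) * P h x y.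
Proof.
move=> t0 h0 Sx Sy; have th0 : 0 <= t + h by exact: addr_ge0.
have mt : measurable (event t x) by exact: X_meas.
have mth : measurable (event (t + h) y) by exact: X_meas.
have ml' l1 : all (fun a => 0 <= a.1 <= t) l1 -> measurable (past_event T event l1).
  by apply: past_event_meas => s a; exact: X_meas.
elim: l l' => [|[s z] l IHl] l' /=.
  move=> _ l't; rewrite !setTI; have := X_markov l' t h x y l't t0 h0 Sx Sy => /=.
  rewrite (_ : [set w | _ /\ _] = past_event T event l' `&` event t x).
    rewrite !PrE; [|by do ?apply: measurableI => //; exact: ml'..].
    by rewrite -EFinM => -[].
  apply/seteqP; split => w [l'w Xt]; split => //; move: l'w; clear.
    by elim: l' => //= -[s u] l' IHl' /andP[/eqP ? /IHl'].
  by elim: l' => //= -[s u] l' IHl' [-> /IHl']; rewrite eqxx.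
move=> /andP[/andP[s0 st] lt] l't.
have ml : measurable (past_event V image_event l).
  by apply: past_event_meas lt => s' a; exact: image_event_meas.
have mlx : measurable (past_event V image_event l `&` (past_event T event l' `&` event t x)).
  by do ?apply: measurableI => //; exact: ml'.
set M := past_event V _ l `&` _ in mlx.
rewrite (_ : _ `&` event (t + h) y = (M `&` event (t + h) y) `&` image_event s z); last first.
  by rewrite /M; apply/seteqP; split => w /=; tauto.
rewrite (_ : _ `&` (_ `&` event t x) = M `&` image_event s z); last first.
  by rewrite /M; apply/seteqP; split => w /=; tauto.
rewrite !p_split//; last exact: measurableI.
rewrite mulr_suml; apply: eq_big_seq => x' /fiberS Sx'.
have := IHl ((s, x') :: l') lt; rewrite /= s0 st l't => /(_ isT).
by congr (p _ = p _ * _); rewrite /M; apply/seteqP; split => w /=; tauto.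
Qed.

(** Observations are listed from the most recent one backwards, so that induction peels off the last
    observation first. *)
Fixpoint decreasing_times (t : R) (l : seq (R * V)) : bool :=
  if l is (s, _) :: l' then (s <= t) && decreasing_times s l' else 0 <= t.

Let decreasing_times_all t l : decreasing_times t l ->
  (0 <= t) && all (fun a => 0 <= a.1 <= t) l.
Proof.
elim: l t => [|[s z] l IHl] t /=; first by move->.
move=> /andP[st /IHl /andP[s0 ls]]; rewrite s0 st (le_trans s0 st) /=.
by apply: sub_all ls => a /andP[-> /le_trans]; apply.
Qed.

(** Induction on the observations: from time [s] to time [t], [averaged_factor] carries the weights
    [k u * L] on the fiber of [u] to [k u * P' (t - s) u (b x) * L x], so the product form survives.
    The base case starts from [L] on the fiber of [z0]. *)
Let fiber_law_factors l (t : R) : decreasing_times t l ->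
  exists k : V -> R, forall x, S x ->
    p (past_event V image_event l `&` event t x) = k (b x) * L x.
Proof.
elim: l t => [|[s u] l IHl] t /=.
  move=> t0; exists (P' t z0) => x Sx; rewrite setTI mulrC -averaged_factor//.
  have mt : measurable (event t x) by exact: X_meas.
  have m0 : measurable (image_event 0 z0) by exact: image_event_meas.
  have p0 : p (image_event 0 z0) = 1.
    rewrite -[image_event _ _]setTI p_split//.
    rewrite -(L_sum z0 Wz0); apply: eq_big_seq => y /fibP[Sy yz].
    by rewrite setTI /p X_init// muE// yz eqxx mul1r.
  (* Starting over [z0] has probability 1, so this event may be intersected with any other. *)
  have -> : p (event t x) = p (event t x `&` image_event 0 z0).
    have mC : measurable (~` image_event 0 z0) by exact: measurableC.
    have : Pr (~` image_event 0 z0) = 0%E.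
      by have := probability_setC Pr m0; rewrite (PrE _ m0) p0 subee.
    move=> /(subset_measure0 (measurableI _ _ mt mC) mC (@subIsetr _ _ _)) pC.
    have : Pr (event t x) = (Pr (event t x `\` image_event 0 z0) +
        Pr (event t x `&` image_event 0 z0))%E by exact: measureDI.
    rewrite setDE pC add0e !PrE//; last exact: measurableI.
    by case.
  rewrite p_split// /G; apply: eq_big_seq => y /fibP[Sy yz].
  have := markov_image_past [::] [::] 0 t y x (lexx 0) t0 Sy Sx isT isT.
  rewrite /= !setTI add0r setIC => ->; congr (_ * _).
  by rewrite /p X_init// muE// yz eqxx mul1r.
move=> /andP[st ls]; have [k kE] := IHl _ ls.
have /andP[s0 l_s] := decreasing_times_all _ _ ls.
have ts0 : 0 <= t - s by rewrite subr_ge0.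
exists (fun z => k u * P' (t - s) u z) => x Sx.
have t0 := le_trans s0 st.
have ml : measurable (past_event V image_event l).
  by apply: past_event_meas l_s => s' a; exact: image_event_meas.
have mt : measurable (event t x) by exact: X_meas.
rewrite -setIA setIC p_split//; last exact: measurableI.
rewrite -mulrA [P' _ _ _ * _]mulrC.
(* Outside [W] the fiber is empty, because [b] maps [S] into [W], and both sides are 0. *)
have [Wu|nWu] := pselect (W u); last first.
  have fu0 : fib u = [::].
    case E0 : (fib u) => [//|y r].
    by have /fibP[Sy yu] : y \in fib u; [rewrite E0 mem_head|case: nWu; rewrite -yu; exact: bS].
  rewrite fu0 big_nil /P' /image_transition big1 ?mulr0// => y _.
  by rewrite /G fu0 big_nil.
rewrite -averaged_factor// /G mulr_sumr; apply: eq_big_seq => y /fibP[Sy yu].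
have := markov_image_past l [::] s (t - s) y x s0 ts0 Sy Sx l_s isT.
rewrite /= !setTI subrKC.
rewrite [X in p X = _](_ : _ = past_event V image_event l `&` event t x `&` event s y).
  by move=> ->; rewrite kE// yu mulrA.
by apply/seteqP; split => w /=; tauto.
Qed.

(** Summing the product form over the fiber of [b x] identifies the constant [k (b x)]: given the
    observed images, the state has law [L] on the fiber. *)
Let fiber_law l (t : R) x : decreasing_times t l -> S x ->
  p (past_event V image_event l `&` event t x) =
  p (past_event V image_event l `&` image_event t (b x)) * L x.
Proof.
move=> tl Sx; have /andP[t0 lt] := decreasing_times_all _ _ tl.
have [k kE] := fiber_law_factors _ _ tl; rewrite kE//; congr (_ * _).
rewrite p_split//; last first.
  by apply: past_event_meas lt => s' a; exact: image_event_meas.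
rewrite -(L_sum_fiber (b x) (k (b x)) (bS _ Sx)); apply: eq_big_seq => y /fibP[Sy yx].
by rewrite kE// yx mulrC.
Qed.

Let image_markov_sorted l (t h : R) z z' : decreasing_times t l -> 0 <= h ->
  p (past_event V image_event l `&` image_event t z `&` image_event (t + h) z') =
  p (past_event V image_event l `&` image_event t z) * P' h z z'.
Proof.
move=> tl h0; have /andP[t0 lt] := decreasing_times_all _ _ tl.
have th0 : 0 <= t + h by exact: addr_ge0.
have ml : measurable (past_event V image_event l).
  by apply: past_event_meas lt => s' a; exact: image_event_meas.
rewrite p_split//; last by apply: measurableI => //; exact: image_event_meas.
rewrite /P' /image_transition mulr_sumr; apply: eq_big_seq => y /fiberS Sy.
have mh : measurable (event (t + h) y) by exact: X_meas.
rewrite -setIA [_ `&` event _ _]setIC setIA p_split//; last exact: measurableI.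
rewrite /G mulr_sumr; apply: eq_big_seq => x /fibP[Sx xz].
have := markov_image_past l [::] t h x y t0 h0 Sx Sy lt isT.
rewrite /= setTI -setIA [event t x `&` _]setIC setIA => ->.
by rewrite fiber_law// xz mulrA.
Qed.

Let later (a a' : R * V) := a'.1 <= a.1.

Let sorted_decreasing_times (t : R) l : 0 <= t -> all (fun a => 0 <= a.1 <= t) l ->
  sorted later l -> decreasing_times t l.
Proof.
have tr : transitive later by move=> a a' a'' /[swap]; exact: le_trans.
elim: l t => [//|[s z] l IHl] t t0 /= /andP[/andP[s0 ->] lt] sl /=.
apply: IHl => //; last exact: path_sorted sl.
apply/allP => a al; have /andP[-> _] := allP lt _ al.
exact: (allP (order_path_min tr sl)).
Qed.

Lemma measurable_image (t : R) z : 0 <= t -> measurable [set w | b (X t w) = z].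
Proof. exact: image_event_meas. Qed.

Lemma image_initial_law z : W z -> Pr [set w | b (X 0 w) = z] = ((z == z0)%:R)%:E.
Proof.
move=> Wz; rewrite PrE; last exact: measurable_image.
rewrite -[X in p X]setTI p_split// -[RHS](congr1 EFin (L_sum_fiber z _ Wz)).
congr EFin; apply: eq_big_seq => y /fibP[Sy yz].
by rewrite setTI /p X_init// muE// yz mulrC.
Qed.

Lemma image_markov : markov_property Pr W P' (fun t w => b (X t w)).
Proof.
move=> past t h z z' pt t0 h0 Wz Wz' A.
(* The past comes in arbitrary order; sorting changes neither its event nor the bounds on its
   times. *)
pose l := sort later past.
have tot : total later by move=> a a'; exact: le_total.
have tl : decreasing_times t l.
  apply: sorted_decreasing_times => //; last exact: sort_sorted.
  by rewrite (perm_all _ (_ : perm_eq l past))// perm_sort.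
have /andP[_ lt] := decreasing_times_all _ _ tl.
have ml : measurable (past_event V image_event l).
  by apply: past_event_meas lt => s' a; exact: image_event_meas.
have AE : A = past_event V image_event l `&` image_event t z.
  rewrite /A; apply/seteqP; split => w /= [lw Xt]; split => //; move: lw;
    rewrite -(perm_all _ (_ : perm_eq l past)) ?perm_sort//; clear.
    by elim: l => //= -[s u] l' IHl' /andP[/eqP ? /IHl'].
  by elim: l => //= -[s u] l' IHl' [-> /IHl']; rewrite eqxx.
rewrite -/(image_event (t + h) z') AE !PrE.
- by rewrite image_markov_sorted// EFinM.
- by apply: measurableI => //; exact: image_event_meas.
- by do ?apply: measurableI => //; apply: image_event_meas; rewrite ?addr_ge0.
Qed.

End Process.

End Kernel.

Lemma markov_process_image (d : measure_display) (Omega : measurableType d)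
    (Pr : probability Omega R) (X : R -> Omega -> T) (mu : T -> R) (z0 : V) :
  W z0 -> (forall x, S x -> mu x = (b x == z0)%:R * L x) ->
  markov_process Pr S Q mu X ->
  markov_process Pr W Q' (fun z => (z == z0)%:R) (fun t w => b (X t w)).
Proof.
move=> Wz0 muE [XS Xright Xmeas Xinit [P tf XP]]; split.
- by move=> t w t0; apply: bS; exact: XS.
- by move=> t w t0; apply: filterS (Xright t w t0) => s ->.
- by move=> t z t0; exact: measurable_image.
- by move=> z Wz; exact: (image_initial_law _ _ _ _ mu).
exists (image_transition P); first exact: image_transition_function.
exact: (@image_markov P tf d Omega Pr X mu z0).
Qed.

End Intertwining.

(** * Pushing and blocking *)

Section Particles.
Variable n : nat.
Implicit Types (r : bool) (u v p a c : particle n).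

(* [u] lies in the row above [p], and a jump of [u] in direction [r] would push
   [p] if they shared a site.  At a common site, [u] then blocks jumps of [p] in
   direction [~~ r]. *)
Definition push r u p : bool :=
  (rowno p == (rowno u).+1) &&
  (if odd (rowno u)
   then if r then colno p == colno u else (colno p).+1 == colno u
   else if r then colno p == (colno u).+1 else colno p == colno u).

Definition wall p : bool := odd (rowno p) && (colno p == 1%N).

Lemma rowno_gt0 p : (0 < rowno p)%N. Proof. by []. Qed.

Lemma rowno_le p : (rowno p <= n.+1)%N. Proof. by rewrite /rowno. Qed.

Lemma colno_bounds p : (0 < colno p <= (rowno p).-1./2.+1)%N.
Proof. by rewrite /colno /rowno /= ltn_ord. Qed.

Lemma particle_eq p p' : rowno p = rowno p' -> colno p = colno p' -> p = p'.
Proof.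
case: p p' => [m j] [m' j']; rewrite /rowno /colno /= => -[] mm'.
have {}mm' : m = m' by exact: val_inj.
by subst m' => -[] /val_inj ->.
Qed.

Lemma particle_ex m k : (0 < m <= n.+1)%N -> (0 < k <= m.-1./2.+1)%N ->
  exists p, rowno p = m /\ colno p = k.
Proof.
case: m => // m /= mn; case: k => // k /= km.
exists (Tagged (fun m : 'I_n.+1 => 'I_m./2.+1) (Ordinal km : 'I_(Ordinal mn)./2.+1)).
by [].
Qed.

Local Opaque rowno colno.

Lemma push_row r u p : push r u p -> rowno p = (rowno u).+1.
Proof. by case/andP => /eqP. Qed.

Lemma push_injr r u p p' : push r u p -> push r u p' -> p = p'.
Proof.
move=> /andP[/eqP pr pc] /andP[/eqP pr' pc']; apply: particle_eq; first by rewrite pr pr'.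
by move: pc pc'; case: odd; case: r => /eqP ? /eqP ?; lia.
Qed.

Lemma push_injl r u u' p : push r u p -> push r u' p -> u = u'.
Proof.
move=> /andP[/eqP pr pc] /andP[/eqP pr' pc'].
have uu' : rowno u = rowno u' by lia.
apply: particle_eq => //; rewrite uu' in pc.
by move: pc pc'; case: odd; case: r => /eqP ? /eqP ?; lia.
Qed.

(** [v] and [a] are neighbours in a row, with [u] between them in the row below; [b] is the particle
    between them in the row above. Its column is the smaller of theirs if its row is even and the
    larger if it is odd. *)
Lemma push_up r v u a : push r v u -> push (~~ r) a u ->
  exists b, push (~~ r) b v /\ push r b a.
Proof.
move=> /andP[/eqP ur uc] /andP[/eqP ur' uc'].
have va : rowno a = rowno v by lia.
have [vb ab] := (colno_bounds v, colno_bounds a).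
have [v0 vn] := (rowno_gt0 v, rowno_le v).
have vn1 := rowno_le v.
rewrite va in uc' ab.
pose k := if odd (rowno v) then minn (colno v) (colno a) else maxn (colno v) (colno a).
have [] := @particle_ex (rowno v).-1 k.
- by move: uc uc'; case: r; case: ifP => /= ? /eqP ? /eqP ?; lia.
- by rewrite /k; move: uc uc'; case: r; case: ifP => /= ? /eqP ? /eqP ?; lia.
move=> b [br bc]; exists b; rewrite /push va.
have rv : rowno v = (rowno b).+1 by move: uc uc'; case: r; case: ifP => /= ? /eqP ? /eqP ?; lia.
rewrite rv eqxx /=; move: uc uc' bc; rewrite /k rv /=.
by case: (odd (rowno b)); case: r => /= /eqP ? /eqP ? ?; lia.
Qed.

(** The mirror image of [push_up]: [b] lies between [c] and [a] in the row below them. *)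
Lemma push_down r u c a : push r u c -> push (~~ r) u a -> (rowno c <= n)%N ->
  exists b, push r a b /\ push (~~ r) c b.
Proof.
move=> /andP[/eqP cr cc] /andP[/eqP ar ac] cn.
have [cb ab] := (colno_bounds c, colno_bounds a).
have ca : rowno a = rowno c by lia.
rewrite ca in ab ar.
pose k := if odd (rowno u) then maxn (colno c) (colno a) else minn (colno c) (colno a).
have [] := @particle_ex (rowno c).+1 k.
- by lia.
- by rewrite /k; move: cc ac; case: r; case: ifP => /= ? /eqP ? /eqP ?; lia.
move=> b [br bc]; exists b; rewrite /push ca br eqxx /=.
move: cc ac bc; rewrite /k cr /=.
by case: (odd (rowno u)); case: r => /= /eqP ? /eqP ? ?; lia.
Qed.

End Particles.

Arguments push {n} r u p.
Arguments wall {n} p.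

(** * Patterns and blocking in terms of the push relation *)

Section Patterns.
Variable n : nat.
Implicit Types (r : bool) (u v p a c : particle n) (x y : config n).

Definition ordered r (i j : int) : bool := if r then i <= j else j <= i.

(** Both kinds of interlacing are inequalities between neighbours in two rows, and each such pair is
    a push pair for exactly one direction. This form treats rows of both parities alike. *)
Lemma interlacedE x (m m' : 'I_n.+1) : m' = m.+1 :> nat ->
  interlaced x m m' <->
  (forall r u p, tag u = m -> tag p = m' -> push r u p -> ordered r (x u) (x p)).
Proof.
move=> mm'; pose pt (m : 'I_n.+1) (j : 'I_m./2.+1) : particle n :=
  Tagged (fun m : 'I_n.+1 => 'I_m./2.+1) j.
have pushE r (i : 'I_m./2.+1) (j : 'I_m'./2.+1) : push r (pt m i) (pt m' j) =
    if odd m.+1 then if r then j == i :> nat else j.+1 == i :> nat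
    else if r then j == i.+1 :> nat else j == i :> nat.
  by rewrite /push (_ : _ == _ = true)//; apply/eqP; rewrite /rowno /= mm'.
rewrite /interlaced; split.
  move=> H r [mu i] [mp j] /= Em Em'; subst mu mp; rewrite -/(pt m i) -/(pt m' j) pushE.
  move: H; case: ifP => _ /(_ i j); rewrite !ffunE => -[H1 H2].
    by case: r => /eqP ij; [apply: H1|apply: H2].
  by case: r => /eqP ij; [apply: H2|apply: H1].
move=> H; have {}H r i j : push r (pt m i) (pt m' j) ->
    ordered r (x (pt m i)) (x (pt m' j)) by exact: H.
have := (H true, H false); case: ifP => om -[H1 H2] i j;
  rewrite !ffunE; split => ij.
- by apply: H1; rewrite pushE om ij.
- by apply: H2; rewrite pushE om ij.
- by apply: H2; rewrite pushE om ij.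
- by apply: H1; rewrite pushE om ij.
Qed.

Lemma patternsE x : patterns n x <->
  (forall p, 0 <= x p) /\ (forall r u p, push r u p -> ordered r (x u) (x p)).
Proof.
split=> -[x0 H]; split=> //.
  move=> r u p up; apply: (iffLR (interlacedE x (tag u) (tag p) _)) (up) => //.
    by have := push_row _ _ _ _ up; rewrite /rowno => -[].
  by apply: H; have := push_row _ _ _ _ up; rewrite /rowno => -[].
by move=> m m' mm'; apply/interlacedE => // r u p _ _; exact: H.
Qed.

(** The decidable negation of [blocked] on patterns: the obstructions are a particle above at the
    same site that would push the other way, and the wall. *)
Definition free r p x : bool :=
  [forall u, push (~~ r) u p ==> (x u != x p)] &&
  ~~ [&& ~~ r, wall p & x p == 0].

Lemma blockedE r p x : patterns n x -> blocked r p x <-> ~~ free r p x.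
Proof.
move=> /patternsE[x0 H]; rewrite /free negb_and negbK negb_forall; split.
  case=> [[m pm nI]|[nr op /eqP cp /eqP xp]]; last first.
    by rewrite nr /wall op cp xp orbT.
  apply/orP; left; apply/existsP; apply: contrapT => nE.
  have nb u : push (~~ r) u p -> x u <> x p.
    by move=> up xu; apply: nE; exists u; rewrite up xu eqxx.
  apply: nI; apply/(interlacedE _ _ _ pm) => r' u c um cp uc.
  rewrite !ffunE; have -> : (u == p) = false.
    by apply/eqP => up; move: pm; rewrite -up um; lia.
  have [cp'|_] := eqVneq c p; last exact: H.
  subst c; have := H _ _ _ uc; move: uc (nb u); rewrite /ordered /step.
  by case: (r) (r') => -[] /= u_p nu; try (have := nu u_p); lia.
case/orP=> [/existsP[u]|/and3P[nr /andP[op /eqP cp] /eqP xp]]; last by right.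
rewrite negb_imply negbK => /andP[up /eqP xu]; left.
have ru : tag p = (tag u).+1 :> nat by have := push_row _ _ _ _ up; rewrite /rowno => -[].
exists (tag u) => // /(interlacedE _ _ _ ru) /(_ _ u p erefl erefl up).
rewrite !ffunE eqxx xu; have -> : (u == p) = false.
  by apply/eqP => E; move: ru; rewrite E => /n_Sn.
by rewrite /ordered /step; case: r {up} => /=; lia.
Qed.

End Patterns.

Arguments free {n} r p x.

(** * Reachability in graphs with unique successors or predecessors *)

Section Connect.
Variables (T : finType) (e : rel T).

Lemma connect_first u v : connect e u v -> u = v \/ exists2 w, e u w & connect e w v.
Proof.
case/connectP => -[|w s] /=; first by move=> _ ->; left.
by case/andP => uw ws ->; right; exists w => //; apply/connectP; exists s.
Qed.

Lemma connect_last u v : connect e u v -> u = v \/ exists2 w, connect e u w & e w v.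
Proof.
case/connectP => s; elim/last_ind: s => [|s w _] /=; first by move=> _ ->; left.
rewrite rcons_path last_rcons => /andP[us sw] ->; right; exists (last u s) => //.
by apply/connectP; exists s.
Qed.

Lemma connect_ind_forward (P : T -> Prop) u : P u ->
  (forall v w, connect e u v -> P v -> e v w -> P w) -> forall v, connect e u v -> P v.
Proof.
move=> Pu step_ v /connectP[s]; elim/last_ind: s v => [|s w IHs] v /=; first by move=> _ ->.
rewrite rcons_path last_rcons => /andP[us sw] ->.
by apply: step_ sw; [apply/connectP; exists s|exact: IHs us _].
Qed.

Lemma connect_ind_backward (P : T -> Prop) v : P v ->
  (forall u w, connect e w v -> P w -> e u w -> P u) -> forall u, connect e u v -> P u.
Proof.
move=> Pv step_ u /connectP[s]; elim: s u => [|w s IHs] u /=; first by move=> _ <-.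
move=> /andP[uw ws] E; apply: step_ uw; last exact: IHs.
by apply/connectP; exists s.
Qed.

Lemma connect_successors u v w : (forall a b c, e a b -> e a c -> b = c) ->
  connect e u v -> connect e u w -> connect e v w \/ connect e w v.
Proof.
move=> fun_e uv uw; move: v uv; apply: connect_ind_forward; first by left.
move=> v v' _ [] vw vv'; last by right; exact: connect_trans (connect1 vv').
case/connect_first: vw => [<-|[v'' vv'' v''w]]; first by right; exact: connect1.
by left; rewrite (fun_e _ _ _ vv' vv'').
Qed.

Lemma connect_predecessors u v w : (forall a b c, e a c -> e b c -> a = b) ->
  connect e u w -> connect e v w -> connect e u v \/ connect e v u.
Proof.
move=> fun_e uw vw; move: u uw; apply: connect_ind_backward; first by right.
move=> u' u _ [] uv u'u; first by left; exact: connect_trans (connect1 u'u) uv.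
case/connect_last: uv => [->|[u'' vu'' u''u]]; first by left; exact: connect1.
by right; rewrite (fun_e _ _ _ u'u u''u).
Qed.

End Connect.

(** * Chains of pushes, and how to undo a jump *)

Section Chains.
Variable n : nat.
Implicit Types (r : bool) (u v p a c : particle n) (x y : config n).
Local Opaque rowno colno.
Local Notation chain r x := (connect (pushes r x)).

Lemma pushesE r x u p : pushes r x u p = push r u p && (x p == x u).
Proof. by rewrite /pushes /push andbA. Qed.

Lemma chain_site r x u p : chain r x u p -> x p = x u.
Proof.
move: p; apply: connect_ind_forward => [//|v w _ IH].
by rewrite pushesE => /andP[_ /eqP ->].
Qed.

Lemma chain_row r x u p : chain r x u p -> u = p \/ (rowno u < rowno p)%N.
Proof.
move: p; apply: connect_ind_forward; first by left.
move=> v w _ H; rewrite pushesE => /andP[/push_row -> _]; right.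
by case: H => [->|/ltnW].
Qed.

Lemma chain_row_le r x u p : chain r x u p -> (rowno u <= rowno p)%N.
Proof. by case/chain_row => [->|/ltnW]. Qed.

Lemma pushes_injr r x u p p' : pushes r x u p -> pushes r x u p' -> p = p'.
Proof. by rewrite !pushesE => /andP[up _] /andP[/(push_injr _ _ _ _ _ up)]. Qed.

Lemma pushes_injl r x u u' p : pushes r x u p -> pushes r x u' p -> u = u'.
Proof. by rewrite !pushesE => /andP[up _] /andP[/(push_injl _ _ _ _ _ up)]. Qed.

(** The candidate for the state before a jump into [y] whose last pushed particle is [p]: [p] and
    all particles that could have pushed it, directly or not, go back by one site. *)
Definition back r p y : config n :=
  [ffun u => if chain r y u p then y u - step r else y u].

(** The upper end of the chain leading to [p], that is, the particle whose own attempt started the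
    jump. *)
Definition top r y p u : bool := chain r y u p && [forall v, ~~ pushes r y v u].

(** Away from the wall some particle above bounds [p] from the left; it is nonnegative and, by
    freedom, strictly smaller. At the wall, freedom itself excludes 0. *)
Lemma free_gt0 p x : patterns n x -> free false p x -> 0 < x p.
Proof.
move=> /patternsE[x0 H] /andP[/forallP nb nw]; rewrite lt_neqAle x0 andbT eq_sym.
case: (boolP (wall p)) => wp; first by move: nw; rewrite wp.
have [u up] : exists u, push true u p.
  have := colno_bounds n p; move: wp; rewrite /wall => wp cp.
  have [] := @particle_ex n (rowno p).-1 (if odd (rowno p) then (colno p).-1 else colno p).
  - by have := rowno_le n p; have := rowno_gt0 n p; lia.
  - by move: wp cp; case: ifP => /=; have := rowno_gt0 n p; lia.
  move=> u [ru cu]; exists u; rewrite /push ru prednK ?rowno_gt0// eqxx /=.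
  by move: cu wp cp; have := rowno_gt0 n p; case: ifP; case: ifP; lia.
have := nb u; have := H _ _ _ up; rewrite /= up /= => xu /eqP xup.
apply/eqP => x0p; apply: xup.
by have := x0 u; move: xu; rewrite x0p; lia.
Qed.

(** If [a] obstructed a pushed particle [u], the particle [b] given by [push_up] would be squeezed
    onto the same site and obstruct the pusher [v] already. *)
Lemma free_chain r p x u : patterns n x -> free r p x -> chain r x p u ->
  forall a, push (~~ r) a u -> x a <> x u.
Proof.
move=> /patternsE[x0 H] /andP[/forallP nb _].
move: u; apply: connect_ind_forward.
  by move=> a ap; apply/eqP; have := nb a; rewrite ap.
move=> v u _ IH; rewrite pushesE => /andP[vu /eqP xu] a au xa.
have [b [bv ba]] := push_up _ _ _ _ _ vu au.
apply: (IH _ bv); have := H _ _ _ bv; have := H _ _ _ ba; rewrite xa xu.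
by rewrite /ordered; case: (r) => /=; lia.
Qed.

Lemma jump_pattern r p x : patterns n x -> free r p x -> patterns n (jump r p x).
Proof.
move=> Px fp; have := Px => /patternsE[x0 H]; apply/patternsE; split.
  move=> u; rewrite ffunE; case: ifP => // pu; rewrite /step.
  case: r fp pu => fp pu; first by have := x0 u; lia.
  by have := free_gt0 _ _ Px fp; rewrite -(chain_site _ _ _ _ pu); lia.
move=> r' u c uc; have xuc := H _ _ _ uc; rewrite !ffunE.
have [E|E] := eqVneq (x u) (x c); last first.
  move: E xuc; rewrite /ordered /step.
  by case: (chain r x p u); case: (chain r x p c); case: (r); case: (r') => /= /eqP; lia.
have [rr'|rr'] := eqVneq r' r.
  subst r'; case: ifP => pu; case: ifP => pc //.
  - by move: xuc; rewrite E /ordered; case: (r); lia.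
  - move: pc; rewrite (connect_trans pu)//; apply: connect1.
    by rewrite pushesE uc E eqxx.
  - by rewrite E /ordered /step; case: (r); lia.
have r'E : r' = ~~ r by move: rr'; case: (r); case: (r').
subst r'; case: ifP => pu; case: ifP => pc //.
- by rewrite E /ordered; case: (r) => /=; lia.
- by rewrite E /ordered /step; case: (r) => /=; lia.
- by case: (free_chain _ _ _ _ Px fp pc _ uc).
Qed.

(** The two conditions propagate up the chain together: [S] at a particle gives the strictness [N]
    at its pusher, and [push_down] then gives [S] at the pusher. *)
Lemma back_chain_strict r p y : patterns n y ->
  (forall a, push (~~ r) p a -> y a <> y p) ->
  (forall u a, push r u p -> push (~~ r) u a -> y a <> y p) ->
  forall v, chain r y v p -> forall a, push (~~ r) v a -> y a <> y v.
Proof.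
move=> /patternsE[y0 H] N S v vp.
suff [] : (forall a, push (~~ r) v a -> y a <> y v) /\
  (forall u a, push r u v -> push (~~ r) u a -> y a <> y v) by [].
move: v vp; apply: connect_ind_backward => // v c _ [Nc Sc].
rewrite pushesE => /andP[vc /eqP yc].
have Nv a : push (~~ r) v a -> y a <> y v.
  by move=> va; rewrite -yc; exact: Sc va.
split=> // u a uv ua yav.
have [|b [ab vb]] := push_down _ _ _ _ _ uv ua.
  by have := rowno_le _ c; rewrite (push_row _ _ _ _ vc).
apply: (Nv b vb); have := H _ _ _ ab; have := H _ _ _ vb; rewrite yav /ordered.
by case: (r) => /=; lia.
Qed.

(** The condition on siblings is stated apart because its source varies: above the bottom row it is
    deduced from the first condition by [push_down], in the bottom row from the order of the bottom
    particles. *)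
Lemma back_pattern r p y : patterns n y ->
  (forall a, push (~~ r) p a -> y a <> y p) ->
  (forall u a, push r u p -> push (~~ r) u a -> y a <> y p) ->
  (r -> 0 < y p) -> patterns n (back r p y).
Proof.
move=> Py N S yp; have := Py => /patternsE[y0 H]; apply/patternsE; split.
  move=> u; rewrite ffunE; case: ifP => // up; rewrite /step.
  case: r {N S} yp up => yp up; last by have := y0 u; lia.
  by have := yp isT; rewrite (chain_site _ _ _ _ up); lia.
move=> r' u c uc; have yuc := H _ _ _ uc; rewrite !ffunE.
have [E|E] := eqVneq (y u) (y c); last first.
  move: E yuc; rewrite /ordered /step.
  by case: (chain r y u p); case: (chain r y c p); case: (r); case: (r') => /= /eqP; lia.
have [rr'|rr'] := eqVneq r' r.
  subst r'; case: ifP => pu; case: ifP => pc //.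
  - by rewrite E /ordered; case: (r); lia.
  - by rewrite E /ordered /step; case: (r); lia.
  - move: pu; rewrite (connect_trans _ pc)//; apply: connect1.
    by rewrite pushesE uc E eqxx.
have r'E : r' = ~~ r by move: rr'; case: (r); case: (r').
subst r'; case: ifP => pu; case: ifP => pc //.
- by rewrite E /ordered; case: (r) => /=; lia.
- by case: (back_chain_strict _ _ _ Py N S _ pu _ uc).
- by rewrite E /ordered /step; case: (r) => /=; lia.
Qed.

Lemma back_strict r p y a : patterns n (back r p y) -> push (~~ r) p a -> y a <> y p.
Proof.
move=> /patternsE[_ H] pa ya; have := H _ _ _ pa; rewrite !ffunE connect0.
case: ifP => [/chain_row_le|_]; first by rewrite (push_row _ _ _ _ pa) ltnn.
by rewrite ya /ordered /step; case: (r) => /=; lia.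
Qed.

(** [p] is recovered as the lowest particle that [back] moves. *)
Lemma back_inj r p p' y : back r p y = back r p' y -> p = p'.
Proof.
move=> E; have chain_of a b : back r a y = back r b y -> chain r y a b.
  move=> /ffunP /(_ a); rewrite !ffunE connect0; case: ifP => // _.
  by rewrite /step; case: (r); lia.
have := chain_of _ _ E; have := chain_of _ _ (esym E).
by move=> /chain_row_le pp' /chain_row[//|]; rewrite ltnNge pp'.
Qed.

Lemma top_ex r y p : exists u, top r y p u.
Proof.
elim: {p}(rowno p) {-2}p (leqnn (rowno p)) => [|m IHm] p pm.
  by have := rowno_gt0 n p; lia.
have [[v vp]|nv] := pselect (exists v, pushes r y v p).
  have [|u /andP[uv tu]] := IHm v.
    by have := vp; rewrite pushesE => /andP[/push_row E _]; rewrite E in pm.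
  by exists u; rewrite /top (connect_trans uv (connect1 vp)).
exists p; rewrite /top connect0 /=; apply/forallP => v; apply/negP => vp.
by apply: nv; exists v.
Qed.

Lemma top_unique r y p u u' : top r y p u -> top r y p u' -> u = u'.
Proof.
move=> /andP[up /forallP nu] /andP[u'p /forallP nu'].
have [] := connect_predecessors _ _ _ _ _ (@pushes_injl r y) up u'p.
  by case/connect_last => // -[w _]; rewrite (negPf (nu' w)).
by case/connect_last => // -[w _]; rewrite (negPf (nu w)).
Qed.

(** In [x] the pushes from [u] run down the chain and stop at [p]: a particle that [p] could push
    has not been moved back, so it no longer shares the site of [p]. *)
Lemma jump_back r p u y : patterns n y -> patterns n (back r p y) -> top r y p u ->
  jump r u (back r p y) = y /\ free r u (back r p y).
Proof.
move=> Py Px /andP[up /forallP nu]; set x := back r p y in Px *.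
have := Py => /patternsE[y0 Hy]; have := Px => /patternsE[x0 Hx].
have chain_x v : chain r x u v = chain r y v p.
  apply/idP/idP.
    move: v; apply: connect_ind_forward => // v w _ vp.
    rewrite pushesE => /andP[vw /eqP xvw].
    case/connect_first: (vp) => [E|[c vc cp]]; last first.
      by have := vc; rewrite pushesE => /andP[/(push_injr _ _ _ _ _ vw) -> _].
    subst v; move: xvw; rewrite !ffunE connect0; case: ifP => // _ yw.
    have := Hy _ _ _ vw; rewrite yw /ordered /step.
    by case: (r) => /=; lia.
  move=> vp; have uv : chain r y u v.
    have [//|] := connect_predecessors _ _ _ _ _ (@pushes_injl r y) up vp.
    by case/connect_last => [-> //|[w _]]; rewrite (negPf (nu w)).
  move: v uv vp; apply: connect_ind_forward => // v w uv IH vw wp.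
  apply: connect_trans (IH _) (connect1 _); first exact: connect_trans (connect1 vw) wp.
  move: (vw); rewrite !pushesE => /andP[-> /eqP yw] /=.
  by rewrite !ffunE wp (connect_trans (connect1 vw) wp) yw.
split.
  apply/ffunP => v; rewrite ffunE chain_x; case: ifP => vp; rewrite ffunE vp //.
  by rewrite subrK.
apply/andP; split.
  apply/forallP => a; apply/implyP => au; apply/eqP.
  rewrite !ffunE up; case: ifP => [ap|_].
    have [/connect_last[E|[w _]]|/chain_row_le] :=
        connect_predecessors _ _ _ _ _ (@pushes_injl r y) ap up.
    - by move: (push_row _ _ _ _ au); rewrite E; lia.
    - by rewrite (negPf (nu w)).
    - by rewrite (push_row _ _ _ _ au) ltnn.
  have := Hy _ _ _ au; rewrite /ordered /step.
  by case: (r) => /=; lia.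
apply/negP => /and3P[nr _]; rewrite ffunE up /step; have := y0 u.
by case: (r) nr => //=; lia.
Qed.

(** [p'] is the lowest particle moved. Pushes form a single line, so the particles pushed from [p]
    in [x] are those leading to [p'] in [y]. With [jump_back], the jumps into [y] in direction [r]
    correspond to the [p'] for which [back r p' y] is a pattern. *)
Lemma back_jump r p x : patterns n x -> free r p x ->
  exists p', back r p' (jump r p x) = x /\ top r (jump r p x) p' p.
Proof.
move=> Px fp; have := Px => /patternsE[x0 Hx]; set y := jump r p x.
have Py : patterns n y by exact: jump_pattern.
have [p' pp' p'max] : exists2 p', chain r x p p' &
    forall u, chain r x p u -> (rowno u <= rowno p')%N.
  by case: (arg_maxnP (@rowno n) (connect0 (pushes r x) p)) => p' ? ?; exists p'.
have chain_y u v : chain r x p u -> chain r x u v -> chain r y u v.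
  move=> pu uv; move: v uv; apply: connect_ind_forward => // v w uv IH vw.
  apply: connect_trans IH (connect1 _); move: (vw); rewrite !pushesE => /andP[-> /eqP xw] /=.
  have pv := connect_trans pu uv.
  by rewrite !ffunE pv (connect_trans pv (connect1 vw)) xw.
have nop v : ~~ pushes r y v p.
  rewrite pushesE; apply/negP => /andP[vp]; rewrite !ffunE connect0.
  case: ifP => [/chain_row_le|_ /eqP xp]; first by rewrite (push_row _ _ _ _ vp) ltnn.
  by have := Hx _ _ _ vp; rewrite -xp /ordered /step; case: (r) => /=; lia.
have py : chain r y p p' by exact: chain_y.
have chainE u : chain r x p u = chain r y u p'.
  apply/idP/idP => [pu|up'].
    apply: chain_y => //.
    have [//|] := connect_successors _ _ _ _ _ (@pushes_injr r x) pu pp'.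
    by move=> /chain_row[->//|]; rewrite ltnNge p'max.
  have pu : chain r y p u.
    have [//|] := connect_predecessors _ _ _ _ _ (@pushes_injl r y) py up'.
    by case/connect_last => [-> //|[w _]]; rewrite (negPf (nop w)).
  move: u pu up'; apply: connect_ind_forward => // v w pv IH vw wp'.
  have vp' := connect_trans (connect1 vw) wp'; have {}pv := IH vp'.
  have [vp''|] := connect_successors _ _ _ _ _ (@pushes_injr r x) pv pp'; last first.
    case/chain_row => [E|]; last by rewrite ltnNge p'max.
    have := chain_row_le _ _ _ _ wp'; move: vw; rewrite pushesE E => /andP[/push_row ->].
    by rewrite ltnn.
  case/connect_first: vp'' => [E|[c vc _]].
    have := chain_row_le _ _ _ _ wp'; move: vw; rewrite pushesE E => /andP[/push_row ->].
    by rewrite ltnn.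
  have -> : w = c.
    move: vw vc; rewrite !pushesE => /andP[vw _] /andP[vc _].
    exact: push_injr vw vc.
  exact: connect_trans pv (connect1 vc).
exists p'; split; last by rewrite /top py; apply/forallP.
by apply/ffunP => u; rewrite ffunE -chainE; case: ifP => pu; rewrite ffunE pu ?addrK.
Qed.

(** A chain has one particle in each row from that of [u] to that of [p], so the product
    telescopes. *)
Lemma chain_prod (R : fieldType) (rho : nat -> R) r y p u :
  (forall m, rho m != 0) -> top r y p u ->
  \prod_(v | chain r y v p) (rho (rowno v) / rho (rowno v).+1) =
  rho (rowno u) / rho (rowno p).+1.
Proof.
move=> rho0 /andP[up /forallP nu]; move: p up; apply: connect_ind_forward.
  rewrite (big_pred1 u)// => v; apply/idP/eqP => [|->//].
  by case/connect_last => // -[w _]; rewrite (negPf (nu w)).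
move=> v w _ IH vw; rewrite (bigD1 w)//= (eq_bigl (fun v' => chain r y v' v)); last first.
  move=> v'; apply/andP/idP => [[]|v'v].
    case/connect_last => [->|]; first by rewrite eqxx.
    by move=> [v'' v'v'' v''w] _; rewrite (pushes_injl _ _ _ _ _ vw v''w).
  split; first exact: connect_trans v'v (connect1 vw).
  apply/eqP => E; subst v'; move: (chain_row_le _ _ _ _ v'v) vw.
  by rewrite pushesE => wv /andP[/push_row E _]; rewrite E ltnn in wv.
rewrite IH; move: vw; rewrite pushesE => /andP[/push_row -> _].
by rewrite mulrC mulrA divfK.
Qed.

End Chains.

Arguments back {n} r p y.
Arguments top {n} r y p u.

(** * Weights and flows *)

Section Weights.
Variables (n : nat) (R : realType) (q : 'I_n./2.+1 -> R).
Hypothesis q_gt0 : forall i, 0 < q i.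
Implicit Types (r : bool) (u v p a c : particle n) (x y : config n).
Local Notation chain r x := (connect (pushes r x)).

(* The rate of right attempts in row [m], with the convention that the row
   below the bottom one has rate 1; left attempts have the inverse rate. *)
Definition rho (m : nat) : R :=
  if (n.+1 < m)%N then 1
  else if odd m then q (inord m.-1./2) else (q (inord m.-1./2))^-1.

Lemma rho_odd i : (i.*2 <= n)%N -> rho i.*2.+1 = q (inord i).
Proof. by move=> iln; rewrite /rho ltnNge ltnS iln /= odd_double /= doubleK. Qed.

Lemma rho_even i : (i.*2 < n)%N -> rho i.*2.+2 = (q (inord i))^-1.
Proof. by move=> iln; rewrite /rho ltnNge ltnS iln /= odd_double /= uphalf_double. Qed.

Definition signed_rate r (m : nat) : R := if r then rho m else (rho m)^-1.

Lemma rho_gt0 m : 0 < rho m.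
Proof. by rewrite /rho; case: ifP => // _; case: ifP; rewrite ?invr_gt0. Qed.

Lemma rho_neq0 m : rho m != 0. Proof. by rewrite gt_eqF ?rho_gt0. Qed.

Lemma signed_rate_below_bottom r : signed_rate r n.+2 = 1.
Proof. by rewrite /signed_rate /rho ltnSn invr1; case: r. Qed.

Lemma attempt_rateE r p : attempt_rate q r p = signed_rate r (rowno p).
Proof.
rewrite /attempt_rate /signed_rate /rho /param ltnNge rowno_le /=.
by rewrite /rowno /=; case: (odd (tag p)); case: r; rewrite ?invrK.
Qed.

Let rowsum_sum x m : rowsum x m = \sum_p (rowno p == m)%:Z * x p.
Proof.
rewrite /rowsum big_mkcond /=; apply: eq_bigr => p _.
by case: eqP; rewrite ?mul1r ?mul0r.
Qed.

(** Numbering from 1, a particle in row 2i-1 above the bottom contributes [q_i ^ 2] per unit and one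
    in row 2i contributes [1 / (q_i q_(i+1))]: both are quotients of consecutive [rho]. In the
    bottom row the convention [rho n.+2 = 1] gives the right factor. *)
Lemma wt_prod x : wt q x = \prod_p (rho (rowno p) / rho (rowno p).+1) ^ x p.
Proof.
(* The exponent of [q i] per unit of [x p]. *)
pose e (i : 'I_n./2.+1) p : int := if i.*2.+1 == n.+1
  then (rowno p == i.*2.+1)%:Z - (rowno p == i.*2)%:Z
  else (rowno p == i.*2.+1)%:Z *+ 2 - (rowno p == i.*2)%:Z - (rowno p == i.*2.+2)%:Z.
have eE i : wt_exponent x i = \sum_p e i p * x p.
  rewrite /wt_exponent !rowsum_sum /e; case: ifP => _.
    by rewrite -sumrB; apply: eq_bigr => p _; rewrite mulrBl.
  rewrite -sumrMnl -!sumrB; apply: eq_bigr => p _.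
  by rewrite !mulrBl mulrnAl.
have qexp i : q i ^ (\sum_p e i p * x p) = \prod_p (q i ^ e i p) ^ x p.
  rewrite (big_morph (fun z => q i ^ z) (id1 := 1) (op1 := *%R)) ?expr0z//; last first.
    by move=> a b /=; rewrite expfzDr// gt_eqF.
  by apply: eq_bigr => p _; rewrite exprz_exp.
transitivity (\prod_p (\prod_i q i ^ e i p) ^ x p).
  rewrite /wt (eq_bigr _ (fun i _ => congr1 (fun z => q i ^ z) (eE i))).
  rewrite (eq_bigr _ (fun i _ => qexp i)) exchange_big /=; apply: eq_bigr => p _.
  rewrite (big_morph (fun z => z ^ x p) (id1 := 1) (op1 := *%R)) ?exp1rz//.
  by move=> a b /=; rewrite expfzMl.
apply: eq_bigr => p _; congr (_ ^ _).
rewrite /e {e eE qexp}.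
have := rowno_le n p; have := rowno_gt0 n p; move: (rowno p) => m m0 mn.
have kn : (m.-1./2 < n./2.+1)%N by lia.
pose k : 'I_n./2.+1 := inord m.-1./2.
have kE : k = m.-1./2 :> nat by rewrite inordK.
rewrite /rho [(n.+1 < m)%N]ltnNge mn /= -/k.
have [om|em] := boolP (odd m).
  have other (i : 'I_n./2.+1) : i != k ->
      [/\ (m == i.*2.+1) = false, (m == i.*2) = false & (m == i.*2.+2) = false].
    by rewrite -val_eqE /= kE => ik; split; apply/negP => /eqP; lia.
  rewrite (bigD1 k)//= big1 ?mulr1 => [|i /other[-> -> ->]]; last by case: ifP.
  have -> : (m == k.*2.+1) by rewrite kE; lia.
  have -> : (m == k.*2) = false by rewrite kE; lia.
  have -> : (m == k.*2.+2) = false by rewrite kE; lia.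
  have -> : (k.*2.+1 == n.+1) = (n.+1 < m.+1)%N by rewrite kE; lia.
  case: ifP => _; first by rewrite subr0 expr1z divr1.
  rewrite (_ : m./2 = m.-1./2); last by lia.
  by rewrite -/k invrK (_ : _ - _ - _ = 2%:Z)// -exprnP expr2.
have vkE : (k.*2.+2 = m)%N by rewrite kE; lia.
have q_k : q k ^ (if k.*2.+1 == n.+1 then (m == k.*2.+1)%:Z - (m == k.*2)%:Z
    else (m == k.*2.+1)%:Z *+ 2 - (m == k.*2)%:Z - (m == k.*2.+2)%:Z) = (q k)^-1.
  have -> : (k.*2.+1 == n.+1) = false by lia.
  have -> : (m == k.*2.+1) = false by lia.
  have -> : (m == k.*2) = false by lia.
  by rewrite vkE eqxx mul0rn subr0 sub0r.
have [nm|nm] := ltnP n.+1 m.+1.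
  rewrite (bigD1 k)//= q_k big1 ?mulr1 ?divr1// => i; rewrite -val_eqE /= => ik.
  have -> : (m == i.*2.+1) = false by lia.
  have -> : (m == i.*2) = false by have := ltn_ord i; lia.
  have -> : (m == i.*2.+2) = false by lia.
  by case: ifP.
(* An even row above the bottom also occurs in the exponent of the next parameter. *)
have lkn : (k.+1 < n./2.+1)%N by lia.
pose l : 'I_n./2.+1 := Ordinal lkn.
have q_l : q l ^ (if l.*2.+1 == n.+1 then (m == l.*2.+1)%:Z - (m == l.*2)%:Z
    else (m == l.*2.+1)%:Z *+ 2 - (m == l.*2)%:Z - (m == l.*2.+2)%:Z) = (q l)^-1.
  have -> : (m == l.*2.+1) = false by rewrite /=; lia.
  have -> : (m == l.*2) by rewrite /=; lia.
  have -> : (m == l.*2.+2) = false by rewrite /=; lia.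
  by rewrite mul0rn subr0 sub0r if_same.
rewrite (bigD1 k)//= q_k (bigD1 l) /=; last by rewrite -val_eqE /=; lia.
rewrite q_l big1 ?mulr1; last first.
  move=> i /andP[]; rewrite -!val_eqE /= => ik il.
  have -> : (m == i.*2.+1) = false by lia.
  have -> : (m == i.*2) = false by lia.
  have -> : (m == i.*2.+2) = false by lia.
  by case: ifP.
congr (_ / _); congr q.
by apply: val_inj; rewrite /= inordK; lia.
Qed.

Lemma wt_gt0 x : 0 < wt q x.
Proof. by rewrite /wt prodr_gt0// => i _; rewrite exprz_gt0. Qed.

(** All particles of the chain move back one step, so by [chain_prod] the change of weight trades
    the rate of the row of [u] for that of the row below [p]. *)
Lemma wt_back r p u y : top r y p u ->
  wt q (back r p y) * signed_rate r (rowno u) = wt q y * signed_rate r (rowno p).+1.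
Proof.
move=> tu; have := chain_prod n R rho r y p u rho_neq0 tu; rewrite !wt_prod => E.
have -> : \prod_v (rho (rowno v) / rho (rowno v).+1) ^ back r p y v =
  (\prod_v (rho (rowno v) / rho (rowno v).+1) ^ y v) *
  (\prod_(v | chain r y v p) (rho (rowno v) / rho (rowno v).+1)) ^ (- step r).
  rewrite (big_morph (fun z => z ^ (- step r)) (id1 := 1) (op1 := *%R)) ?exp1rz//; last first.
    by move=> a b /=; rewrite expfzMl.
  rewrite [X in _ = _ * X]big_mkcond -big_split /=; apply: eq_bigr => v _; rewrite ffunE.
  case: ifP => _; rewrite ?mulr1// -expfzDr//.
  by rewrite mulf_neq0 ?invr_neq0 ?rho_neq0.
rewrite E -mulrA; congr (_ * _); rewrite /signed_rate /step; case: (r).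
  by rewrite exprN1 invf_div divfK// rho_neq0.
by rewrite opprK expr1z mulrC mulrA mulVf ?mul1r// rho_neq0.
Qed.

End Weights.

Arguments rho {n R} q m.
Arguments signed_rate {n R} q r m.

(** * Fibers over a bottom row, and the edges of the array of particles *)

Section Fibers.
Variable n : nat.
Implicit Types (r : bool) (u v p a c : particle n) (x y : config n) (z : vec n./2.+1).

Definition bottom (i : 'I_n./2.+1) : particle n :=
  Tagged (fun m : 'I_n.+1 => 'I_m./2.+1) (i : 'I_(@ord_max n)./2.+1).

Lemma bottom_rowE x i : bottom_row x i = x (bottom i).
Proof. by rewrite /bottom_row /row_of ffunE. Qed.

Lemma rowno_bottom i : rowno (bottom i) = n.+1. Proof. by []. Qed.

Lemma colno_bottom i : colno (bottom i) = i.+1. Proof. by []. Qed.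

Lemma bottom_ex p : rowno p = n.+1 -> exists i, p = bottom i.
Proof.
case: p => m j; rewrite /rowno /= => -[] mn.
have mE : m = ord_max by exact: val_inj.
by subst m; exists j.
Qed.

Lemma bottom_inj : injective bottom.
Proof.
by move=> i j /(congr1 (@colno n)); rewrite !colno_bottom => -[] /val_inj.
Qed.

Local Opaque rowno colno.

Lemma push_right_ex u : (rowno u <= n)%N -> exists p, push true u p.
Proof.
move=> un; have cu := colno_bounds n u; have ru := rowno_gt0 n u.
have [||p [rp cp]] := @particle_ex n (rowno u).+1 (if odd (rowno u) then colno u else (colno u).+1).
- by lia.
- by case: ifP => /=; lia.
by exists p; rewrite /push rp eqxx cp; case: (odd (rowno u)); exact: eqxx.
Qed.

Lemma push_left_ex u : (rowno u <= n)%N -> ~~ wall u -> exists p, push false u p.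
Proof.
move=> un; have cu := colno_bounds n u; have ru := rowno_gt0 n u; rewrite /wall => wu.
have [||p [rp cp]] := @particle_ex n (rowno u).+1 (if odd (rowno u) then (colno u).-1 else colno u).
- by lia.
- by move: wu; case: ifP => /=; lia.
by exists p; rewrite /push rp eqxx cp; move: wu; case: (odd (rowno u)) => /=; lia.
Qed.

Lemma wall_not_push_left u p : wall u -> ~~ push false u p.
Proof.
move=> /andP[ou /eqP cu]; rewrite /push ou cu; have := colno_bounds n p.
by case: (rowno p == _) => //=; lia.
Qed.

Lemma wall_not_pushed_right u p : wall p -> ~~ push true u p.
Proof.
move=> /andP[op /eqP cp]; rewrite /push cp; have := colno_bounds n u.
by case: eqP => //= E; rewrite ifF; lia.
Qed.

Lemma pushed_right_ex p : ~~ wall p -> exists u, push true u p.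
Proof.
move=> wp; have cp := colno_bounds n p; have pn := rowno_le n p; have p0 := rowno_gt0 n p.
move: wp; rewrite /wall => wp.
have [||u [ru cu]] := @particle_ex n (rowno p).-1 (if odd (rowno p) then (colno p).-1 else colno p).
- by lia.
- by move: wp; case: ifP => /=; lia.
have rp : rowno p = (rowno u).+1 by lia.
exists u; rewrite /push rp eqxx cu; move: wp; rewrite rp /=.
by case: (odd (rowno u)) => /=; lia.
Qed.

Lemma pushed_left_ex p : colno p != (rowno p).-1./2.+1 -> exists u, push false u p.
Proof.
move=> wp; have cp := colno_bounds n p; have pn := rowno_le n p; have p0 := rowno_gt0 n p.
have [||u [ru cu]] := @particle_ex n (rowno p).-1 (if odd (rowno p) then colno p else (colno p).+1).
- by lia.
- by case: ifP => /=; lia.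
have rp : rowno p = (rowno u).+1 by lia.
exists u; rewrite /push rp eqxx cu rp /=.
by case: (odd (rowno u)) => /=; lia.
Qed.

Lemma last_not_pushed_left u p : colno p = (rowno p).-1./2.+1 -> ~~ push false u p.
Proof.
move=> cp; rewrite /push cp; have := colno_bounds n u; have := rowno_gt0 n u.
by case: eqP => //= ->; case: ifP => /=; lia.
Qed.

Lemma le_bottom x p : patterns n x -> exists i, x p <= bottom_row x i.
Proof.
move=> /patternsE[x0 H].
have [m] := ubnP (n.+1 - rowno p); elim: m p => // m IHm p pm.
have [pn|pn] := leqP (rowno p) n; last first.
  have [|i ->] := bottom_ex p; first by have := rowno_le n p; lia.
  by exists i; rewrite bottom_rowE.
have [p' pp'] := push_right_ex p pn.
have [|i xi] := IHm p'; first by rewrite (push_row _ _ _ _ pp'); lia.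
by exists i; apply: le_trans xi; exact: (H _ _ _ pp').
Qed.

Lemma patterns_at_finite z : finite_set (patterns_at z).
Proof.
(* Every particle is bounded by some bottom entry, hence by [B], so the patterns over [z] come from
   functions into a finite set. *)
pose B := absz (\sum_i `|z i|).
pose f (g : {ffun particle n -> 'I_B.+1}) : config n := [ffun p => Posz (g p)].
apply: (@sub_finite_set _ _ (f @` setT)); last exact/finite_image/finite_finset.
move=> x [Px xz]; have := Px => /patternsE[x0 _].
exists [ffun p => inord (absz (x p))] => //; apply/ffunP => p.
rewrite !ffunE inordK; first by rewrite gez0_abs.
have [i xi] := le_bottom x p Px.
have zB : z i <= \sum_i `|z i|.
  rewrite (bigD1 i)//= (le_trans (ler_norm _))// lerDl sumr_ge0//.
by rewrite ltnS /B; have := x0 p; move: xi; rewrite xz; lia.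
Qed.

Definition fiber z : seq (config n) := fset_set (patterns_at z).

Lemma fiberP z x : x \in fiber z <-> patterns n x /\ bottom_row x = z.
Proof.
rewrite /fiber in_fset_set; last exact: patterns_at_finite.
by rewrite in_setE.
Qed.

Lemma fiber_uniq z : uniq (fiber z).
Proof. exact: fset_uniq. Qed.

Lemma bottom_weyl x : patterns n x -> weyl0 _ (bottom_row x).
Proof.
move=> /patternsE[x0 H]; split=> [i|i j]; rewrite !bottom_rowE//.
have [k] := ubnP (j - i)%N; elim: k i j => // k IHk i j jk ij.
have [/val_inj -> //|ij'] := eqVneq (i : nat) j.
have iS : (i.+1 < n./2.+1)%N by have := ltn_ord j; lia.
pose i' : 'I_n./2.+1 := Ordinal iS.
apply: (@le_trans _ _ (x (bottom i'))); last by apply: IHk; rewrite /=; lia.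
(* [u], in the row above, separates the neighbouring bottom particles [i] and [i']. *)
have [||u [ru cu]] := @particle_ex n n (if odd n then i.+2 else i.+1).
- by lia.
- by case: ifP => /=; lia.
have ui' : push true u (bottom i').
  by rewrite /push ru cu rowno_bottom colno_bottom eqxx; case: (odd n); exact: eqxx.
have ui : push false u (bottom i).
  by rewrite /push ru cu rowno_bottom colno_bottom eqxx; case: (odd n); exact: eqxx.
by have := H _ _ _ ui; have := H _ _ _ ui'; rewrite /ordered => /[swap]; exact: le_trans.
Qed.

Lemma weyl_fiber z : weyl0 _ z -> exists x, x \in fiber z.
Proof.
move=> [z0 zm].
(* Rows are aligned on the right: the j-th particle from the right in any row gets the j-th entry of
   [z] from the right. *)
pose f (p : particle n) : 'I_n./2.+1 := inord (n./2 - ((rowno p).-1./2.+1 - colno p)).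
have fE p : f p = (n./2 - ((rowno p).-1./2.+1 - colno p))%N :> nat by rewrite inordK; lia.
exists [ffun p => z (f p)]; apply/fiberP; split.
  apply/patternsE; split=> [p|r u p up]; rewrite !ffunE ?z0//.
  have := colno_bounds n p; have := colno_bounds n u.
  have := rowno_le n p; have := rowno_gt0 n u.
  move: up => /andP[/eqP ru]; rewrite /ordered ru /=.
  by case: ifP; case: r => /= ? /eqP ? ? ? ? ?; apply: zm; rewrite !fE; lia.
apply/ffunP => i; rewrite bottom_rowE ffunE; congr (z _).
by apply: ord_inj; rewrite fE rowno_bottom colno_bottom /=; have := ltn_ord i; lia.
Qed.

End Fibers.

Arguments bottom {n} i.
Arguments fiber {n} z.

(** * Balance of the flows into and out of a pattern *)

Section Flow.
Variables (n : nat) (R : realType) (q : 'I_n./2.+1 -> R).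
Hypothesis q_gt0 : forall i, 0 < q i.
Implicit Types (r : bool) (u v p a c : particle n) (x y : config n) (z : vec n./2.+1).
Local Notation chain r x := (connect (pushes r x)).
Local Opaque rowno colno.

(** A jump into [y] is indexed by its direction and its last moved particle instead of its origin:
    [back_jump] and [jump_back] justify the change of index, and [wt_back] converts the rates. *)
Lemma inflow z y : patterns n y ->
  \sum_(x <- fiber z) wt q x *
    (\sum_p \sum_r (free r p x)%:R * signed_rate q r (rowno p) * (y == jump r p x)%:R) =
  wt q y * \sum_r \sum_p (back r p y \in fiber z)%:R * signed_rate q r (rowno p).+1.
Proof.
move=> Py.
pose G r x p := (free r p x)%:R * (y == jump r p x)%:R * (wt q x * signed_rate q r (rowno p)).
transitivity (\sum_r \sum_(x <- fiber z) \sum_p G r x p).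
  rewrite exchange_big /=; apply: eq_bigr => x _.
  rewrite exchange_big mulr_sumr; apply: eq_bigr => p _.
  by rewrite mulr_sumr; apply: eq_bigr => r _; rewrite /G; ring.
rewrite mulr_sumr; apply: eq_bigr => r _.
transitivity (\sum_(x <- fiber z) \sum_u \sum_p
    (back r p y == x)%:R * ((top r y p u)%:R * G r x u)).
  apply: eq_big_seq => x /fiberP[Px _]; apply: eq_bigr => u _.
  under eq_bigr do rewrite mulrA; rewrite -mulr_suml.
  have [/andP[fu /eqP yE]|] := boolP (free r u x && (y == jump r u x)); last first.
    move=> nG; have -> : G r x u = 0; last by rewrite mulr0.
    move: nG; rewrite /G; case: (free r u x); case: (y == _) => //= _;
      by rewrite ?mul0r ?mulr0 ?mul0r.
  have [p' [bp tp]] := back_jump _ _ _ _ Px fu; rewrite -yE in bp tp.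
  rewrite (bigD1 p')//= bp eqxx tp mulr1 big1 ?addr0 ?mul1r// => p pp'.
  case: eqP => [E|]; last by rewrite mul0r.
  by rewrite -bp in E; rewrite (back_inj _ _ _ _ _ E) eqxx in pp'.
under eq_bigr do rewrite exchange_big /=.
rewrite exchange_big mulr_sumr; apply: eq_bigr => p _ /=.
under eq_bigr do rewrite -mulr_sumr.
have [bz|bz] := boolP (back r p y \in fiber z); last first.
  rewrite mul0r mulr0 big_seq big1// => x xz.
  by case: eqP => [E|]; [rewrite -E (negPf bz) in xz|rewrite mul0r].
rewrite sum_eq_mem ?fiber_uniq// mul1r.
have [Pb _] : patterns n (back r p y) /\ bottom_row (back r p y) = z by apply/fiberP.
have [u tu] := top_ex n r y p.
rewrite (bigD1 u)//= tu mul1r big1 ?addr0 => [|v vu]; last first.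
  case: (boolP (top r y p v)) => [tv|]; last by rewrite mul0r.
  by rewrite (top_unique _ _ _ _ _ _ tv tu) eqxx in vu.
have [jE fE] := jump_back _ _ _ _ _ Py Pb tu.
by rewrite /G jE fE eqxx !mul1r wt_back.
Qed.

Lemma shiftedE z r i j :
  shifted z r i j = if j == i then z j + step r else z j.
Proof. by rewrite ffunE. Qed.

(** For [p] above the bottom row of a pattern, the criterion for [back r p y] to be a pattern again;
    the last condition keeps a wall particle from being sent back to -1. *)
Definition clear_below r p y : bool :=
  [forall a, push (~~ r) p a ==> (y a != y p)] && ~~ [&& r, wall p & y p == 0].

Lemma back_bottom_row r p y i : bottom_row (back r p y) i =
  if chain r y (bottom i) p then bottom_row y i - step r else bottom_row y i.
Proof. by rewrite !bottom_rowE ffunE. Qed.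

Lemma back_pattern_upper r p y : patterns n y -> (rowno p <= n)%N ->
  clear_below r p y -> patterns n (back r p y).
Proof.
move=> Py pn /andP[/forallP nb nw]; have := Py => /patternsE[y0 H].
have N a : push (~~ r) p a -> y a <> y p.
  by move=> pa; apply/eqP; have := nb a; rewrite pa.
apply: back_pattern => // [u a up ua yap|rT].
  have [b [ab pb]] := push_down _ _ _ _ _ up ua pn.
  apply: (N _ pb); have := H _ _ _ ab; have := H _ _ _ pb; rewrite yap /ordered.
  by case: (r) => /=; lia.
rewrite lt_neqAle y0 andbT eq_sym; apply/eqP => yp0.
case: (boolP (wall p)) => wp; first by rewrite rT wp yp0 in nw.
have [a pa] := push_left_ex _ _ pn wp; have := H _ _ _ pa.
move: (N a); rewrite rT => /(_ pa); have := y0 a; rewrite yp0 /=; lia.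
Qed.

Lemma back_fiber_same r p y : patterns n y ->
  (back r p y \in fiber (bottom_row y)) = (rowno p <= n)%N && clear_below r p y.
Proof.
move=> Py; apply/idP/andP => [/fiberP[Pb bE]|[pn cp]].
  split.
    rewrite leqNgt; apply/negP => pn.
    have [|i pE] := bottom_ex _ p; first by have := rowno_le n p; lia.
    have := back_bottom_row r p y i; rewrite bE pE connect0 /step.
    by case: (r); lia.
  apply/andP; split.
    apply/forallP => a; apply/implyP => pa; apply/eqP.
    exact: back_strict Pb pa.
  apply/negP => /and3P[rT wp /eqP yp0].
  have := Pb => /patternsE[/(_ p) + _]; rewrite ffunE connect0 yp0 /step rT; lia.
apply/fiberP; split; first exact: back_pattern_upper.
apply/ffunP => i; rewrite back_bottom_row; case: ifP => // /chain_row_le.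
by rewrite rowno_bottom; lia.
Qed.

(** The sibling condition of [back_pattern] comes from the order of [z]: the bottom neighbour behind
    particle [i] is weakly behind it in [z], hence strictly behind after the move. *)
Lemma back_fiber_shifted r i z y : patterns n y -> weyl0 _ z ->
  bottom_row y = shifted z r i -> back r (bottom i) y \in fiber z.
Proof.
move=> Py [z0 zm] yE.
have yi j : y (bottom j) = if j == i then z j + step r else z j.
  by rewrite -bottom_rowE yE ffunE.
have noa a : push (~~ r) (bottom i) a -> False.
  by move=> /push_row; rewrite rowno_bottom; have := rowno_le n a; lia.
apply/fiberP; split; last first.
  apply/ffunP => j; rewrite back_bottom_row yE ffunE.
  case: (eqVneq j i) => [->|ji]; first by rewrite connect0 addrK.
  case: ifP => // /chain_row [/bottom_inj E|]; first by rewrite E eqxx in ji.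
  by rewrite !rowno_bottom ltnn.
apply: back_pattern => // [a /noa //|u a ui ua|rT]; last first.
  by rewrite yi eqxx /step rT; have := z0 i; lia.
have ra : rowno a = n.+1.
  by rewrite (push_row _ _ _ _ ua) -(push_row _ _ _ _ ui) rowno_bottom.
have [j aE] := bottom_ex _ a ra; rewrite aE !yi eqxx.
have : if r then (j < i)%N else (i < j)%N.
  move: ui ua; rewrite aE /push !rowno_bottom !colno_bottom.
  case: (r) => /=; case: (n.+1 == _) => //=; case: (odd (rowno u)) => /=; lia.
have [E|_] := eqVneq j i; first by rewrite E; case: (r); rewrite ltnn.
rewrite /step; case: (r) => /ltnW /zm; lia.
Qed.

Lemma back_fiber_other r p z y : z != bottom_row y -> back r p y \in fiber z ->
  exists i, p = bottom i /\ bottom_row y = shifted z r i.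
Proof.
move=> zy /fiberP[Pb bE].
have [pn|pn] := leqP (rowno p) n.
  move: zy; rewrite -bE; case/eqP; apply/ffunP => i; rewrite back_bottom_row.
  by case: ifP => // /chain_row_le; rewrite rowno_bottom; lia.
have [|i pE] := bottom_ex _ p; first by have := rowno_le n p; lia.
exists i; split=> //; apply/ffunP => j; rewrite shiftedE -bE back_bottom_row pE.
case: (eqVneq j i) => [->|ji]; first by rewrite connect0 subrK.
case: ifP => // /chain_row [/bottom_inj E|]; first by rewrite E eqxx in ji.
by rewrite !rowno_bottom ltnn.
Qed.

Lemma shifted_inj z r r' i i' : shifted z r i = shifted z r' i' -> r = r' /\ i = i'.
Proof.
move=> E; have ii' : i = i'.
  move/ffunP: E => /(_ i); rewrite !ffunE eqxx /step; case: eqP => // _.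
  by case: (r); lia.
split=> //; move/ffunP: E => /(_ i); rewrite !ffunE ii' eqxx /step.
by case: (r); case: (r') => //; lia.
Qed.

(** Only the one bottom particle that distinguishes [z] from the bottom row of [y] can have moved
    last, and its term is 1 because the row below the bottom has rate 1. *)
Lemma inflow_shifted z y : patterns n y -> weyl0 _ z -> z != bottom_row y ->
  \sum_r \sum_p (back r p y \in fiber z)%:R * signed_rate q r (rowno p).+1 =
  ([exists r, exists i, bottom_row y == shifted z r i])%:R.
Proof.
move=> Py Wz zy.
case: (boolP [exists r, _]) => [/existsP[r /existsP[i /eqP yE]]|nE].
  rewrite (bigD1 r)//= (bigD1 (bottom i))//= back_fiber_shifted// mul1r rowno_bottom.
  rewrite signed_rate_below_bottom.
  rewrite big1 ?addr0 => [|p pi]; last first.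
    case: (boolP (_ \in _)) => [/(back_fiber_other _ _ _ _ zy)[j [pj yE']]|]; last by rewrite mul0r.
    by have [_ ij] := shifted_inj _ _ _ _ _ (etrans (esym yE) yE'); rewrite pj ij eqxx in pi.
  rewrite big1 ?addr0// => r' rr'; rewrite big1// => p _.
  case: (boolP (_ \in _)) => [/(back_fiber_other _ _ _ _ zy)[j [pj yE']]|]; last by rewrite mul0r.
  by have [r'r _] := shifted_inj _ _ _ _ _ (etrans (esym yE) yE'); rewrite r'r eqxx in rr'.
rewrite big1// => r _; rewrite big1// => p _.
case: (boolP (_ \in _)) => [/(back_fiber_other _ _ _ _ zy)[i [_ yE]]|]; last by rewrite mul0r.
by case/negP: nE; apply/existsP; exists r; apply/existsP; exists i; rewrite yE.
Qed.

(* A particle [u] and its child [p] for [push (~~ r)] obstruct each other in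
   direction [r]: [p] is blocked by [u] exactly when [u] cannot have made the
   last move of a push. *)
Let interior r y := \sum_u \sum_p (push (~~ r) u p && (y p != y u))%:R * signed_rate q r (rowno p).

(** Each [p] has at most one obstructing particle above; the particles without one make up the
    boundary sum. *)
Lemma outflow_split r y :
  \sum_p (free r p y)%:R * signed_rate q r (rowno p) = interior r y +
  \sum_(p | ~~ [exists u, push (~~ r) u p]) (free r p y)%:R * signed_rate q r (rowno p).
Proof.
rewrite /interior exchange_big /= (bigID (fun p => [exists u, push (~~ r) u p]))/=.
congr (_ + _); rewrite [RHS](bigID (fun p => [exists u, push (~~ r) u p]))/=.
rewrite [X in _ + X]big1 ?addr0; last first.
  move=> p nup; rewrite big1// => u _.
  case: (boolP (push _ _ _)) => [up|_]; last by rewrite mul0r.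
  by case/negP: nup; apply/existsP; exists u.
apply: eq_bigr => p /existsP[u up]; rewrite (bigD1 u)//= up big1 ?addr0 => [|u' uu']; last first.
  case: (boolP (push _ _ _)) => [u'p|_]; last by rewrite mul0r.
  by rewrite (push_injl _ _ _ _ _ u'p up) eqxx in uu'.
congr ((nat_of_bool _)%:R * _); rewrite /free; have -> : ~~ [&& ~~ r, wall p & y p == 0].
  apply/negP => /and3P[nr wp _]; move: up; rewrite nr.
  by rewrite (negPf (wall_not_pushed_right _ u p wp)).
rewrite andbT; apply/forallP/idP => [/(_ u)|yup u']; first by rewrite up eq_sym.
by apply/implyP => /(push_injl _ _ _ _ _ up) <-; rewrite eq_sym.
Qed.

(** The same pairs seen from the upper particle [u]: the rate of the row below [u] is the rate of
    [p], which gives the same [interior]. *)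
Lemma inflow_split r y :
  \sum_u ((rowno u <= n)%N && clear_below r u y)%:R * signed_rate q r (rowno u).+1 =
  interior r y + \sum_(u | (rowno u <= n)%N && ~~ [exists p, push (~~ r) u p])
    (clear_below r u y)%:R * signed_rate q r (rowno u).+1.
Proof.
rewrite (bigID (fun u => [exists p, push (~~ r) u p]))/=; congr (_ + _); last first.
  rewrite [LHS]big_mkcond [RHS]big_mkcond /=; apply: eq_bigr => u _.
  by case: (_ <= _)%N => //=; case: ifP => // _; rewrite mul0r.
rewrite /interior [RHS](bigID (fun u => [exists p, push (~~ r) u p]))/=.
rewrite [X in _ + X]big1 ?addr0; last first.
  move=> u nup; rewrite big1// => p _.
  case: (boolP (push _ _ _)) => [up|_]; last by rewrite mul0r.
  by case/negP: nup; apply/existsP; exists p.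
apply: eq_bigr => u /existsP[p up]; rewrite (bigD1 p)//= up big1 ?addr0 => [|p' pp']; last first.
  case: (boolP (push _ _ _)) => [up'|_]; last by rewrite mul0r.
  by rewrite (push_injr _ _ _ _ _ up' up) eqxx in pp'.
rewrite -(push_row _ _ _ _ up); congr ((nat_of_bool _)%:R * _).
have -> : (rowno u <= n)%N by have := rowno_le n p; rewrite (push_row _ _ _ _ up).
rewrite /clear_below; have -> : ~~ [&& r, wall u & y u == 0].
  apply/negP => /and3P[rT wu _]; move: up; rewrite rT.
  by rewrite (negPf (wall_not_push_left _ u p wu)).
rewrite andbT; apply/forallP/idP => [/(_ p)|yup p']; first by rewrite up.
by apply/implyP => /(push_injr _ _ _ _ _ up) <-.
Qed.

(** The particles that nothing above pushes to the left are the last ones of the rows, one in each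
    row. *)
Lemma sum_last_column (F : nat -> R) :
  \sum_(p : particle n | ~~ [exists u, push false u p]) F (rowno p) = \sum_(m < n.+1) F m.+1.
Proof.
pose last_p (m : 'I_n.+1) : particle n :=
  Tagged (fun m : 'I_n.+1 => 'I_m./2.+1) (ord_max : 'I_m./2.+1).
rewrite (partition_big (fun p : particle n => tag p) predT)//=.
apply: eq_bigr => m _.
have rl : rowno (last_p m) = m.+1 by [].
have cl : colno (last_p m) = (rowno (last_p m)).-1./2.+1 by [].
rewrite -rl (big_pred1 (last_p m))// => p.
apply/andP/eqP => [[nup /eqP pm]|->]; last first.
  split=> //; apply/negP => /existsP[u].
  by rewrite (negPf (last_not_pushed_left _ u _ cl)).
have rp : rowno p = m.+1 by rewrite -pm.
apply: particle_eq; first by rewrite rp.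
rewrite cl rl -rp; apply/eqP; apply: contraNT nup => /pushed_left_ex[u up].
by apply/existsP; exists u.
Qed.

Lemma sum_doubled (F : nat -> R) k :
  \sum_(m < k.*2) F m = \sum_(i < k) (F i.*2 + F i.*2.+1).
Proof.
by elim: k => [|k IHk]; rewrite ?big_ord0// doubleS !big_ord_recr /= IHk addrA.
Qed.

Lemma sum_rho : \sum_(m < n.+1) rho q m.+1 =
  if odd n.+1 then \sum_(i | i != ord_max) (q i + (q i)^-1) + q ord_max
  else \sum_i (q i + (q i)^-1).
Proof.
have pairs k : (k.*2 <= n.+1)%N -> \sum_(m < k.*2) rho q m.+1 =
    \sum_(i < k) (q (inord i) + (q (inord i))^-1).
  move=> kn; rewrite (sum_doubled (fun m => rho q m.+1)); apply: eq_bigr => i _.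
  by rewrite (rho_odd n R q) ?(rho_even n R q)//; have := ltn_ord i; lia.
case: ifP => on.
  have nE : n.+1 = (n./2).*2.+1 by move: on => /=; lia.
  have -> : \sum_(m < n.+1) rho q m.+1 = \sum_(m < (n./2).*2.+1) rho q m.+1 by rewrite -nE.
  rewrite big_ord_recr /= pairs; last by lia.
  rewrite (rho_odd n R q); last by lia.
  have nm : inord n./2 = ord_max :> 'I_n./2.+1 by apply: val_inj; rewrite /= inordK.
  rewrite nm; congr (_ + _); apply: (addrI (q ord_max + (q ord_max)^-1)).
  rewrite -(bigD1 (P := predT) (F := fun i => q i + (q i)^-1) ord_max)//=.
  rewrite big_ord_recr /= addrC; congr (_ + _); apply: eq_bigr => i _.
  have -> // : inord i = widen_ord (leqnSn n./2) i.
  by apply: val_inj; rewrite /= inordK//; have := ltn_ord i; lia.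
have nE : n.+1 = (n./2.+1).*2 by move: on => /=; lia.
have -> : \sum_(m < n.+1) rho q m.+1 = \sum_(m < (n./2.+1).*2) rho q m.+1 by rewrite -nE.
by rewrite pairs ?nE//; apply: eq_bigr => i _; rewrite inord_val.
Qed.

Let boundary y : R := \sum_(p | wall p) (y p != 0)%:R * (rho q (rowno p))^-1.

Lemma outflow_boundary_right y :
  \sum_(p | ~~ [exists u, push (~~ true) u p]) (free true p y)%:R * signed_rate q true (rowno p) =
  \sum_(m < n.+1) rho q m.+1.
Proof.
rewrite -(sum_last_column (rho q)); apply: eq_bigr => p nup.
have -> : free true p y; last by rewrite mul1r.
rewrite /free andbT; apply/forallP => u; apply/implyP => up.
by case/negP: nup; apply/existsP; exists u.
Qed.

Lemma outflow_boundary_left y :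
  \sum_(p | ~~ [exists u, push (~~ false) u p])
    (free false p y)%:R * signed_rate q false (rowno p) =
  boundary y.
Proof.
have wallE p : ~~ [exists u, push true u p] = wall p.
  apply/idP/idP => [|wp].
    by apply: contraNT => /pushed_right_ex[u up]; apply/existsP; exists u.
  by apply/negP => /existsP[u]; rewrite (negPf (wall_not_pushed_right _ u p wp)).
apply: eq_big => [p|p nup]; first exact: wallE.
congr ((nat_of_bool _)%:R * _); rewrite /free -wallE nup /=.
rewrite (_ : [forall u, _] = true) ?andTb//; apply/forallP => u; apply/implyP => up.
by case/negP: nup; apply/existsP; exists u.
Qed.

Lemma inflow_boundary_left y :
  \sum_(u | (rowno u <= n)%N && ~~ [exists p, push (~~ false) u p])
    (clear_below false u y)%:R * signed_rate q false (rowno u).+1 = 0.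
Proof.
rewrite big1// => u /andP[un /negP[]].
by have [p up] := push_right_ex _ _ un; apply/existsP; exists p.
Qed.

(** Above the bottom row, the particles with nothing to push to the left are the wall particles.
    They sit in odd rows, and the right rate of the next row is the inverse of their own. *)
Lemma inflow_boundary_right y :
  \sum_(u | (rowno u <= n)%N && ~~ [exists p, push (~~ true) u p])
    (clear_below true u y)%:R * signed_rate q true (rowno u).+1 =
  \sum_(u | wall u && (rowno u <= n)%N) (y u != 0)%:R * (rho q (rowno u))^-1.
Proof.
apply: eq_big => [u|u /andP[un nup]].
  have [un|] := leqP (rowno u) n; rewrite ?andbF// andbT /=.
  apply/idP/idP => [|wu].
    by apply: contraNT => /(push_left_ex _ _ un)[p up]; apply/existsP; exists p.
  by apply/negP => /existsP[p]; rewrite (negPf (wall_not_push_left _ u p wu)).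
have wu : wall u.
  by apply: contraNT nup => /(push_left_ex _ _ un)[p up]; apply/existsP; exists p.
congr (_ * _).
  congr ((nat_of_bool _)%:R); rewrite /clear_below wu /=.
  rewrite (_ : [forall a, _] = true) ?andTb//; apply/forallP => a; apply/implyP => ua.
  by case/negP: nup; apply/existsP; exists a.
have /andP[ou _] := wu; have uE : rowno u = (rowno u)./2.*2.+1 by lia.
by rewrite /= uE (rho_odd n R q) ?(rho_even n R q)//; lia.
Qed.

(** The interior terms cancel, and so do the wall particles above the bottom row. There remain the
    right rates of all rows and, if the number of rows is odd, the left rate of the wall particle in
    the bottom row. *)
Lemma flow_difference y : (forall p, 0 <= y p) ->
  \sum_r \sum_p (free r p y)%:R * signed_rate q r (rowno p) -
  \sum_r \sum_u ((rowno u <= n)%N && clear_below r u y)%:R * signed_rate q r (rowno u).+1 =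
  if odd n.+1 then
    \sum_(i | i != ord_max) (q i + (q i)^-1)
    + (q ord_max)^-1 * (0 < bottom_row y ord0)%R%:R + q ord_max
  else \sum_i (q i + (q i)^-1).
Proof.
move=> y0; rewrite !big_bool !outflow_split !inflow_split outflow_boundary_right
  outflow_boundary_left inflow_boundary_left inflow_boundary_right sum_rho.
rewrite /boundary [\sum_(p | wall p) _](bigID (fun p => rowno p <= n)%N) /=.
set s := \sum_(p | wall p && (rowno p <= n)%N) _.
have -> (a b c d : R) : a + c + (b + (s + d)) - (a + s + (b + 0)) = c + d by ring.
have [on|on] := boolP (~~ odd n); last first.
  rewrite [X in _ + X]big1 ?addr0// => p /andP[/andP[op _]]; rewrite -ltnNge => pn.
  by have := rowno_le n p; lia.
rewrite addrAC; congr (_ + _ + _).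
rewrite (big_pred1 (bottom ord0)) => [|p]; last first.
  rewrite -ltnNge; apply/andP/eqP => [[/andP[_ /eqP cp] pn]|->].
    apply: particle_eq; first by rewrite rowno_bottom; have := rowno_le n p; lia.
    by rewrite cp colno_bottom.
  by rewrite /wall rowno_bottom colno_bottom /= on ltnSn.
rewrite rowno_bottom bottom_rowE mulrC; congr (_^-1 * (nat_of_bool _)%:R).
  have nE : n.+1 = n./2.*2.+1 by lia.
  have -> : rho q n.+1 = rho q n./2.*2.+1 by rewrite -nE.
  rewrite (rho_odd n R q); last by lia.
  by congr q; apply: val_inj; rewrite /= inordK.
by rewrite lt_neqAle y0 andbT eq_sym.
Qed.

Lemma flow_balance z y : patterns n y -> weyl0 _ z ->
  \sum_(x <- fiber z) wt q x * pattern_qmatrix q x y =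
  (if bottom_row y == z then bottom_qmatrix q z (bottom_row y)
   else ([exists r, exists i, bottom_row y == shifted z r i])%:R) * wt q y.
Proof.
move=> Py Wz.
have y0 p : 0 <= y p by move: Py => /patternsE[].
have QE x : patterns n x -> pattern_qmatrix q x y =
    (\sum_p \sum_r (free r p x)%:R * signed_rate q r (rowno p) * (y == jump r p x)%:R) -
    (\sum_r \sum_p (free r p x)%:R * signed_rate q r (rowno p)) * (y == x)%:R.
  move=> Px; rewrite mulr_suml [X in _ - X](eq_bigr _ (fun r _ => mulr_suml _ _ _ _)).
  rewrite [X in _ - X]exchange_big /= -sumrB; apply: eq_bigr => p _.
  rewrite -sumrB; apply: eq_bigr => r _.
  have -> : `[< blocked r p x >] = ~~ free r p x by apply/asboolP/idP => /blockedE; exact.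
  by rewrite attempt_rateE; case: (free r p x) => /=; rewrite ?mul0r ?subr0// mul1r mulrBr.
rewrite (eq_big_seq (fun x => wt q x *
    (\sum_p \sum_r (free r p x)%:R * signed_rate q r (rowno p) * (y == jump r p x)%:R) -
    (y == x)%:R * (wt q x * (\sum_r \sum_p
      (free r p x)%:R * signed_rate q r (rowno p))))); last first.
  by move=> x /fiberP[Px _]; rewrite QE//; ring.
rewrite sumrB inflow//.
have [yz|yz] := eqVneq (bottom_row y) z; last first.
  rewrite inflow_shifted// 1?eq_sym// [X in _ - X]big_seq [X in _ - X]big1 ?subr0 1?mulrC//.
  move=> x /fiberP[_ xz]; case: eqP => [yx|_]; last by rewrite mul0r.
  by rewrite yx xz eqxx in yz.
(* Over its own bottom row, [y] receives the jumps that end above the bottom and loses its whole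
   outflow; the net gain is minus [flow_difference]. *)
rewrite sum_eq_mem ?fiber_uniq//; last by apply/fiberP.
rewrite -{}yz -mulrBr mulrC; congr (_ * _).
rewrite /bottom_qmatrix eqxx -flow_difference// opprB; congr (_ - _).
by apply: eq_bigr => r _; apply: eq_bigr => p _; rewrite back_fiber_same.
Qed.

End Flow.

(** * The intertwining of the two generators *)

Section Generator.
Variables (n : nat) (R : realType) (q : 'I_n./2.+1 -> R).
Hypothesis q_gt0 : forall i, 0 < q i.
Implicit Types (r : bool) (p : particle n) (x y : config n) (z : vec n./2.+1).

Lemma SpE z : Sp q z = \sum_(x <- fiber z) wt q x.
Proof. by rewrite /Sp fsbig_finite//; exact: patterns_at_finite. Qed.

Lemma Sp_gt0 z : weyl0 _ z -> 0 < Sp q z.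
Proof.
move=> /weyl_fiber[x xz]; rewrite SpE (bigD1_seq x) ?fiber_uniq//=.
by rewrite ltr_wpDr ?wt_gt0// sumr_ge0// => y _; rewrite ltW ?wt_gt0.
Qed.

Definition kernel_weight x : R := wt q x / Sp q (bottom_row x).

Lemma kernel_weight_ge0 x : patterns n x -> 0 <= kernel_weight x.
Proof. by move=> Px; rewrite divr_ge0 ?ltW ?wt_gt0 ?Sp_gt0//; exact: bottom_weyl. Qed.

Lemma kernel_weight_sum z : weyl0 _ z -> \sum_(x <- fiber z) kernel_weight x = 1.
Proof.
move=> Wz; rewrite (eq_big_seq (fun x => wt q x / Sp q z)); last first.
  by move=> x /fiberP[_ xz]; rewrite /kernel_weight xz.
by rewrite -mulr_suml -SpE divff// gt_eqF ?Sp_gt0.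
Qed.

(** This is [flow_balance] divided by [Sp q z]: off the diagonal, the ratio of [Sp] in
    [bottom_qmatrix] changes the normalization of [wt q y] from its own bottom row to [z]. *)
Lemma generator_intertwining z y : weyl0 _ z -> patterns n y ->
  \sum_(x <- fiber z) kernel_weight x * pattern_qmatrix q x y =
  bottom_qmatrix q z (bottom_row y) * kernel_weight y.
Proof.
move=> Wz Py; rewrite (eq_big_seq (fun x =>
    (Sp q z)^-1 * (wt q x * pattern_qmatrix q x y))); last first.
  by move=> x /fiberP[_ xz]; rewrite /kernel_weight xz; ring.
rewrite -mulr_sumr flow_balance// /kernel_weight.
have [yz|yz] := eqVneq (bottom_row y) z; first by rewrite yz; ring.
rewrite /bottom_qmatrix (negPf yz); case: ifP => _; last by rewrite !mul0r mulr0.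
have Sy : Sp q (bottom_row y) != 0 by rewrite gt_eqF// Sp_gt0//; exact: bottom_weyl.
have Sz : Sp q z != 0 by rewrite gt_eqF// Sp_gt0.
by rewrite mul1r; field; rewrite Sy Sz.
Qed.

(** [x] itself is listed so that the diagonal entry is included and the row of the generator sums to
    0 over the list. *)
Definition successors x : seq (config n) :=
  undup (x :: [seq jump a.1 a.2 x | a <- enum {: bool * particle n} & free a.1 a.2 x]).

Lemma successors_self x : x \in successors x.
Proof. by rewrite mem_undup mem_head. Qed.

Lemma successors_jump r p x : free r p x -> jump r p x \in successors x.
Proof.
move=> fp; rewrite mem_undup inE; apply/orP; right; apply/mapP; exists (r, p) => //.
by rewrite mem_filter fp mem_enum.
Qed.

Lemma successors_patterns x y : patterns n x -> y \in successors x -> patterns n y.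
Proof.
move=> Px; rewrite mem_undup inE => /predU1P[->//|/mapP[[r p]]].
by rewrite mem_filter => /andP[fp _] ->; exact: jump_pattern.
Qed.

Lemma successors_size x : (size (successors x) <= #|{: bool * particle n}|.+1)%N.
Proof.
apply: leq_trans (size_undup _) _; rewrite /= ltnS size_map size_filter cardE.
exact: count_size.
Qed.

Lemma pattern_qmatrixE x y : patterns n x -> pattern_qmatrix q x y =
  \sum_p \sum_r (free r p x)%:R * attempt_rate q r p * ((y == jump r p x)%:R - (y == x)%:R).
Proof.
move=> Px; apply: eq_bigr => p _; apply: eq_bigr => r _.
have -> : `[< blocked r p x >] = ~~ free r p x by apply/asboolP/idP => /blockedE; exact.
by case: (free r p x) => /=; rewrite ?mul0r// mul1r.
Qed.

Lemma successors_out x y : patterns n x -> y \notin successors x ->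
  pattern_qmatrix q x y = 0.
Proof.
move=> Px yx; rewrite pattern_qmatrixE// big1// => p _; rewrite big1// => r _.
have -> : (y == x) = false by apply: contraNF yx => /eqP ->; exact: successors_self.
case: (boolP (free r p x)) => [fp|]; last by rewrite !mul0r.
have -> : (y == jump r p x) = false.
  by apply: contraNF yx => /eqP ->; exact: successors_jump.
by rewrite subrr mulr0.
Qed.

Lemma successors_sum x : patterns n x ->
  \sum_(y <- successors x) pattern_qmatrix q x y = 0.
Proof.
move=> Px; under eq_bigr do rewrite pattern_qmatrixE//.
rewrite exchange_big big1//= => p _; rewrite exchange_big big1//= => r _.
rewrite -mulr_sumr sumrB.
have one y : y \in successors x -> \sum_(y' <- successors x) (y' == y)%:R = 1 :> R.
  move=> yx; rewrite -[RHS](@sum_eq_mem R _ (successors x) y (fun=> 1)) ?undup_uniq//.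
  by apply: eq_bigr => y' _; rewrite mulr1 eq_sym.
case: (boolP (free r p x)) => [fp|]; last by rewrite !mul0r.
by rewrite !one ?subrr ?mulr0//; [exact: successors_self|exact: successors_jump].
Qed.

Lemma pattern_qmatrix_le x y : patterns n x ->
  `|pattern_qmatrix q x y| <= \sum_p \sum_r attempt_rate q r p.
Proof.
move=> Px; rewrite pattern_qmatrixE//; apply: (le_trans (ler_norm_sum _ _ _)).
apply: ler_sum => p _; apply: (le_trans (ler_norm_sum _ _ _)); apply: ler_sum => r _.
have a0 : 0 <= attempt_rate q r p.
  by rewrite /attempt_rate /param; case: ifP => _; rewrite ?invr_ge0 ltW.
rewrite !normrM (ger0_norm a0) -[leRHS]mul1r -[leRHS]mulr1.
apply: ler_pM => //; first by rewrite mulr_ge0.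
  by apply: ler_wpM2r => //; case: (free r p x); rewrite ?normr1 ?normr0.
by case: (y == _); case: (y == x); rewrite ?subrr ?subr0 ?sub0r ?normrN ?normr1 ?normr0.
Qed.

End Generator.

Theorem theorem2p3 (R : realType) (n : nat) (q : 'I_n./2.+1 -> R)
    (z : vec n./2.+1) (d : measure_display) (Omega : measurableType d)
    (Pr : probability Omega R) (X : R -> Omega -> config n) :
  (forall i, 0 < q i < 1) ->
  weyl0 _ z ->
  markov_process Pr (patterns n) (pattern_qmatrix q) (initial_law q z) X ->
  markov_process Pr (weyl0 n./2.+1) (bottom_qmatrix q)
    (fun y => (y == z)%:R) (fun t w => bottom_row (X t w)).
Proof.
move=> q01 Wz; have q0 i : 0 < q i by case/andP: (q01 i).
(* The number of successors is bounded by one plus the number of pairs of a direction and a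
   particle, and the entries of the generator by the total attempt rate. *)
apply: (markov_process_image R _ _ (patterns n) (weyl0 _) (@bottom_row n) fiber
  (kernel_weight n R q) (pattern_qmatrix q) (bottom_qmatrix q) (successors n)
  #|{: bool * particle n}|.+1 (\sum_p \sum_r attempt_rate q r p)) => //.
- exact: bottom_weyl.
- exact: fiber_uniq.
- exact: fiberP.
- exact: kernel_weight_ge0.
- exact: kernel_weight_sum.
- by move=> x _; exact: undup_uniq.
- exact: successors_patterns.
- by move=> x _; exact: successors_self.
- by move=> x _; exact: successors_size.
- by move=> x y Px _; exact: successors_out.
- exact: successors_sum.
- by move=> x y Px _; exact: pattern_qmatrix_le.
- exact: generator_intertwining.
(* The initial law is the kernel weight restricted to the fiber of [z]. *)
move=> x Px; rewrite /initial_law /kernel_weight.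
case: (eqVneq (bottom_row x) z) => [xz|xz].
  by rewrite asboolT ?mul1r ?xz.
by rewrite asboolF ?mul0r// => -[_ /eqP]; rewrite (negPf xz).
Qed.
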